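(* Let $\mathcal{F}$ be a free filter on $\mathbb{N}$. The following statements are equivalent: (1) There exists an infinite-dimensional Banach space $X$ such that the uniform $\mathcal{F}$-boundedness principle holds for $X$. (2) The uniform $\mathcal{F}$-boundedness principle holds for every Fréchet space $X$. (3) $\mathcal{F}$ is both a rapid$^+$ filter and a P$^+$-filter.
   Context: $\mathbb{N}=\{0,1,2,\ldots\}$. A filter on $\mathbb{N}$ is a non-empty, upwards closed family $\mathcal{F}\subsetneq P(\mathbb{N})$ closed under finite intersections; it is free if it contains all cofinite subsets of $\mathbb{N}$. A set $A\subseteq\mathbb{N}$ is $\mathcal{F}$-stationary if $\mathbb{N}\setminus A\notin\mathcal{F}$ (equivalently, $A$ meets every element of $\mathcal{F}$). $(\forall_{\mathcal{F}}\, i\in\mathbb{N})\,\Phi(i)$ means $\{i\in\mathbb{N}:\Phi(i)\}\in\mathcal{F}$. $A\subseteq^* B$ means $A\setminus B$ is finite. For infinite $A\subseteq\mathbb{N}$, $\eta_A:\mathbb{N}\to A$ is the unique strictly increasing surjection. $\mathcal{F}$ is a P$^+$-filter if for every decreasing sequence $(A_k)_k$ of $\mathcal{F}$-stationary sets there is an $\mathcal{F}$-stationary set $B$ with $B\subseteq^* A_k$ for every $k$. $\mathcal{F}$ is a rapid$^+$ filter if for every $\mathcal{F}$-stationary set $I$ and every strictly increasing $f:\mathbb{N}\to\mathbb{N}$ there is an $\mathcal{F}$-stationary set $B\subseteq I$ with $f(n)\le\eta_B(n)$ for all $n$. For topological vector spaces $X,Y$, $\mathcal{L}(X,Y)$ is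 the space of continuous linear maps. A sequence $(y_i)_i$ in $Y$ is $\mathcal{F}$-bounded if for every $0$-neighbourhood $V$ in $Y$ there is $t>0$ with $ty_i\in V$ $(\forall_{\mathcal{F}}\, i\in\mathbb{N})$. A sequence $(T_i)_i$ in $\mathcal{L}(X,Y)$ is pointwise $\mathcal{F}$-bounded if $(T_i(x))_i$ is $\mathcal{F}$-bounded for every $x\in X$; it is $\mathcal{F}$-equicontinuous if for every $0$-neighbourhood $V$ in $Y$ there is a $0$-neighbourhood $U$ in $X$ with $T_i[U]\subseteq V$ $(\forall_{\mathcal{F}}\, i\in\mathbb{N})$. The uniform $\mathcal{F}$-boundedness principle holds for $X$ if for every locally convex space $Y$, every pointwise $\mathcal{F}$-bounded sequence in $\mathcal{L}(X,Y)$ is $\mathcal{F}$-equicontinuous. *)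

(* Defs.v *)
From HB Require Import structures.
From mathcomp Require Import all_boot all_order all_algebra.
From mathcomp Require Import all_classical all_reals all_analysis.
From mathcomp Require Import complex.

Set Implicit Arguments.
Unset Strict Implicit.
Unset Printing Implicit Defensive.

Import Order.TTheory GRing.Theory Num.Theory.
Import numFieldNormedType.Exports.

Local Open Scope classical_set_scope.
Local Open Scope ring_scope.

Definition real_or_complex (R : realType) (K : numFieldType) : Prop :=
  K = (R : numFieldType) \/ K = (R[i] : numFieldType).

Definition free_filter (F : set_system nat) : Prop :=
  forall A : set nat, finite_set (~` A) -> F A.

Definition stationary (F : set_system nat) (A : set nat) : Prop := ~ F (~` A).

Definition almost_subset (A B : set nat) : Prop := finite_set (A `\` B).

Definition strictly_increasing (f : nat -> nat) : Prop :=
  {homo f : m n / (m < n)%N}.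

(* [is_eta A e] says that e is the increasing enumeration eta_A of A; such an
   e exists only if A is infinite, and is then unique. *)
Definition is_eta (A : set nat) (e : nat -> nat) : Prop :=
  strictly_increasing e /\ range e = A.

Definition P_plus_filter (F : set_system nat) : Prop :=
  forall A : nat -> set nat,
    (forall k, A k.+1 `<=` A k) -> (forall k, stationary F (A k)) ->
  exists2 B : set nat, stationary F B & forall k, almost_subset B (A k).

Definition rapid_plus_filter (F : set_system nat) : Prop :=
  forall (I : set nat) (f : nat -> nat),
    stationary F I -> strictly_increasing f ->
  exists B : set nat, [/\ stationary F B, B `<=` I &
    exists2 eta, is_eta B eta & forall n, (f n <= eta n)%N].

(* For K = R[i], [0 < t] forces t to be a positive real. *)
Definition filter_bounded (K : numFieldType) (Y : topologicalLmodType K)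
    (F : set_system nat) (y : nat -> Y) : Prop :=
  forall V : set Y, nbhs 0 V ->
  exists2 t : K, 0 < t & \forall i \near F, V (t *: y i).

Definition pointwise_filter_bounded (K : numFieldType)
    (X Y : topologicalLmodType K) (F : set_system nat)
    (T : nat -> {linear X -> Y}) : Prop :=
  forall x : X, filter_bounded F (fun i => T i x).

Definition filter_equicontinuous (K : numFieldType)
    (X Y : topologicalLmodType K) (F : set_system nat)
    (T : nat -> {linear X -> Y}) : Prop :=
  forall V : set Y, nbhs 0 V ->
  exists2 U : set X, nbhs 0 U & \forall i \near F, T i @` U `<=` V.

(* [tvsType K] is the library's type of locally convex spaces over K. *)
Definition uniform_boundedness_principle (K : numFieldType)
    (F : set_system nat) (X : topologicalLmodType K) : Prop :=
  forall (Y : tvsType K) (T : nat -> {linear X -> Y}),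
    (forall i, continuous (T i)) ->
    pointwise_filter_bounded F T -> filter_equicontinuous F T.

Definition infinite_dimensional (K : numFieldType) (X : lmodType K) : Prop :=
  ~ exists (n : nat) (e : 'I_n -> X),
      forall x : X, exists c : 'I_n -> K, x = \sum_(i < n) c i *: e i.

(* The topology of X is induced by a complete translation-invariant metric;
   together with the local convexity of a [tvsType] this says that X is a
   Frechet space.  Completeness is stated with the metric d because the
   uniformity carried by a [tvsType] is only required to induce its topology,
   not to be translation invariant, so the library's [cauchy] would be wrong. *)
Definition frechet (R : realType) (K : numFieldType) (X : tvsType K) : Prop :=
  exists d : X -> X -> R,
  [/\ forall x y, (d x y == 0) = (x == y),
      forall x y, d x y = d y x,
      forall x y z, d x z <= d x y + d y z &
  [/\ forall x y z, d (x + z) (y + z) = d x y,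
      forall (x : X) (A : set X),
        nbhs x A <-> exists2 e : R, 0 < e & [set y | d x y < e] `<=` A &
      forall u : nat -> X,
        (forall e : R, 0 < e ->
          exists N, forall m n, (N <= m)%N -> (N <= n)%N -> d (u m) (u n) < e) ->
        exists l : X, u @ \oo --> l]].

(* Main.v *)
(* (3) implies (2).  If (T_i) is pointwise F-bounded but not F-equicontinuous,
   the two conditions on F give a stationary set {b_0 < b_1 < ...} and points
   x_n, tending to 0 as fast as desired, such that T_(b_n) x_n is large.  Among
   the sums x of c_n x_n with integers 0 <= c_n < 2 ^ (n + 1), those with
   T_(b_n) x small form a fraction at most 2 ^ - (n + 1), since for given other
   coefficients at most one value of c_n is bad.  Counting and compactness give
   an x that is good for all n, and (T_i x) is not F-bounded.

   (1) implies (3).  If F is not a P+-filter, the principle is refuted by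
   functionals of large norm whose sequences are nearly weak* null (a quantified
   Josefson-Nissenzweig theorem); if F is not rapid+, by blocks of functionals
   of large norm of which few are large at any point.  If either kind of
   functionals did not exist, any sequence of norm one functionals would have
   arbitrarily many terms that are simultaneously large at a point.  By Ramsey's
   theorem a separated sequence would then have a subsequence whose Rademacher
   averages have norm bounded below, while they satisfy a Bessel inequality. *)
Require Import Defs.
From HB Require Import structures.
From mathcomp Require Import all_boot all_order all_algebra.
From mathcomp Require Import all_classical all_reals all_analysis.
From mathcomp Require Import complex.
From mathcomp Require Import ring lra zify.

Set Implicit Arguments.
Unset Strict Implicit.
Unset Printing Implicit Defensive.

Import Order.TTheory GRing.Theory Num.Theory.
Import numFieldNormedType.Exports.

Local Open Scope classical_set_scope.
Local Open Scope ring_scope.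

(** A subset of a stationary set need not be stationary, so the b_n cannot be thinned out as in a
    gliding hump argument: a single x has to serve all n at once. The coefficients are integers
    because the metric is subadditive but not homogeneous; it controls c_n x_n only through c_n d(0,
    x_n).

    The Rademacher averages lead to a contradiction because they are again functionals of norm
    bounded below, so the assumption applies to them too: arbitrarily many of them would be large at
    one point of the unit ball, which the Bessel inequality forbids. In the rapid+ case finite
    families of averages do; in the P+ case an infinite sequence is obtained from ultrafilter
    limits.

    These arguments concern real functionals; complex scalars are reached by restriction of scalars.
    Passing from (2) to (3) requires some infinite-dimensional Banach space, and the bounded scalar
    sequences are used. *)

Section ultralimit.
Variable R : realType.
Implicit Types u v : nat -> R.

Definition bounded_sequence u : Prop := exists C : R, forall n, `|u n| <= C.

(** [L] is the limit along an ultrafilter that contains all tails, so bounds on a tail pass to it.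
    Compatibility with squares carries Bessel inequalities to the limit. The total function [lim] is
    meaningful only on bounded sequences. *)
Lemma ultralimit_exists : exists L : (nat -> R) -> R,
  [/\ forall (a : R) u v, bounded_sequence u -> bounded_sequence v ->
        L (fun n => a * u n + v n) = a * L u + L v,
      forall u, bounded_sequence u -> L (fun n => u n ^+ 2) = L u ^+ 2,
      forall u (C : R) k, bounded_sequence u -> (forall n, (k <= n)%N -> u n <= C) ->
        L u <= C &
      forall u (C : R) k, bounded_sequence u -> (forall n, (k <= n)%N -> C <= u n) ->
        C <= L u].
Proof.
have [U [UU ooU]] := @ultraFilterLemma nat \oo _.
have FU : ProperFilter U by exact: ultra_proper.
have cU u : bounded_sequence u -> u n @[n --> U] --> lim (u n @[n --> U]).
  move=> [C uC]; suff : cvg (u n @[n --> U]) by [].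
  have UC : (u n @[n --> U]) `[- C, C]%classic.
    by apply: (@filterE _ U) => n /=; rewrite in_itv /= -ler_norml.
  have [p [_ pU]] := @segment_compact R (- C) C (u n @[n --> U]) _ UC.
  apply/cvg_ex; exists p => V Vp.
  have [//|nUV] := in_ultra_setVsetC (u @^-1` V) UU.
  have [x [/= nVx Vx]] := pU (~` V) V nUV Vp.
  by exfalso; exact: nVx.
exists (fun u => lim (u n @[n --> U])); split.
- move=> a u v bu bv; apply: cvg_lim => //.
  by apply: cvgD; [apply: cvgMr; exact: cU|exact: cU].
- move=> u bu; apply: cvg_lim => //.
  by under eq_fun do rewrite expr2; rewrite expr2; apply: cvgM; exact: cU.
- move=> u C k bu uC; apply: limr_le; first exact: cU.
  by apply: ooU; exists k.
- move=> u C k bu uC; apply: limr_ge; first exact: cU.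
  by apply: ooU; exists k.
Qed.

End ultralimit.

(** * Norming functionals *)

Section hahn_banach.
Variables (R : realType) (X : lmodType R).
Implicit Types (p q : X -> R) (x y z : X).

Definition sublinear p : Prop :=
  (forall x y, p (x + y) <= p x + p y) /\
  (forall (a : R) x, 0 <= a -> p (a *: x) <= a * p x).

Definition real_linear p : Prop :=
  forall (a : R) x y, p (a *: x + y) = a * p x + p y.

Lemma sublinear0 p : sublinear p -> p 0 = 0.
Proof.
move=> [pD pZ]; apply/eqP; rewrite eq_le; apply/andP; split.
  by have := pZ 0 0 (lexx _); rewrite scale0r mul0r.
by have := pD 0 0; rewrite addr0 lerDl.
Qed.

Lemma sublinear_oppr p x : sublinear p -> - p (- x) <= p x.
Proof. by move=> sp; have := sp.1 x (- x); rewrite subrr sublinear0//; lra. Qed.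

(* Lowers p at - y as far as sublinearity permits. *)
Definition shave p y x : R :=
  inf [set p (x + t *: y) - t * p y | t in [set t | 0 <= t]].

(** Keeps the [inf] in [shave] from taking its default value. *)
Lemma shave_lbound p y x : sublinear p ->
  lbound [set p (x + t *: y) - t * p y | t in [set t | 0 <= t]] (- p (- x)).
Proof.
move=> [pD pZ] _ [t /= t0 <-].
have := pD (x + t *: y) (- x); rewrite addrAC subrr add0r.
have := pD (t *: y) (- (t *: y)); rewrite subrr sublinear0//.
have [->|tn0] := eqVneq t 0.
  by rewrite scale0r addr0 mul0r oppr0 !subr0 => _; have := sublinear_oppr x (conj pD pZ); lra.
have tV0 : 0 <= t^-1 by rewrite invr_ge0.
have := pZ t^-1 (t *: y) tV0; rewrite scalerA mulVf// scale1r => h.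
have : t * p y <= t * (t^-1 * p (t *: y)) by rewrite ler_wpM2l.
by rewrite mulrA divff// mul1r; lra.
Qed.

Lemma shave_le p y x t : sublinear p -> 0 <= t ->
  shave p y x <= p (x + t *: y) - t * p y.
Proof.
move=> sp t0; apply: ge_inf; last by exists t.
by eexists; exact: shave_lbound.
Qed.

Lemma le_shave p y x (c : R) :
  (forall t, 0 <= t -> c <= p (x + t *: y) - t * p y) -> c <= shave p y x.
Proof.
move=> h; apply: lb_le_inf; first by exists (p (x + 0 *: y) - 0 * p y), 0 => /=.
by move=> _ [t /= t0 <-]; exact: h.
Qed.

Lemma shave_sublinear p y : sublinear p -> sublinear (shave p y).
Proof.
move=> sp; split.
  move=> x z; rewrite -lerBlDr; apply: le_shave => t t0.
  rewrite lerBlDr -lerBlDl; apply: le_shave => s s0.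
  rewrite lerBlDl; apply: (le_trans (shave_le _ _ _ (addr_ge0 t0 s0))) => //.
  have := sp.1 (x + t *: y) (z + s *: y).
  by rewrite addrACA -scalerDl; lra.
move=> a x; rewrite le_eqVlt => /orP[/eqP <-|a0].
  rewrite scale0r mul0r; apply: (le_trans (shave_le _ _ _ (lexx 0))) => //.
  by rewrite scale0r addr0 sublinear0// mul0r subr0.
rewrite -ler_pdivrMl//; apply: le_shave => t t0.
rewrite ler_pdivrMl//; apply: (le_trans (shave_le _ _ _ (mulr_ge0 (ltW a0) t0))) => //.
rewrite -scalerA -scalerDr mulrBr mulrA lerB//.
exact: (sp.2 _ _ (ltW a0)).
Qed.

Lemma shave_le_self p y x : sublinear p -> shave p y x <= p x.
Proof.
move=> sp; apply: (le_trans (shave_le _ _ _ (lexx 0))) => //.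
by rewrite scale0r addr0 mul0r subr0.
Qed.

Lemma shave_opp p y : sublinear p -> shave p y (- y) <= - p y.
Proof.
move=> sp; apply: (le_trans (shave_le _ _ _ (@ler01 R))) => //.
by rewrite scale1r addNr mul1r sublinear0// sub0r.
Qed.

(** Zorn's lemma for the reversed pointwise order. A chain is bounded below by its pointwise
    infimum: this is finite because members are at least - p (- x), and subadditive because the
    smaller of two members can be used for both terms. *)
Lemma minimal_sublinear p : sublinear p -> exists q,
  [/\ sublinear q, (forall x, q x <= p x) &
      forall r, sublinear r -> (forall x, r x <= q x) -> r = q].
Proof.
move=> sp.
pose S := {q : X -> R | sublinear q /\ forall x, q x <= p x}.
pose r (a b : S) := `[< forall x, sval b x <= sval a x >].
have [|a b c /asboolP ab /asboolP bc| | |[q [sq qp]] qm] := @Zorn S r.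
- by move=> a; apply/asboolP.
- by apply/asboolP => x; exact: le_trans (bc x) (ab x).
- move=> [a Pa] [b Pb] /asboolP/= ab /asboolP/= ba; apply: eq_exist.
  by apply/funext => x; apply/eqP; rewrite eq_le ab ba.
- move=> A Atot; have [[a0 Aa0]|A0] := pselect (exists a, A a); last first.
    by exists (exist _ p (conj sp (fun=> lexx _))) => s As; case: A0; exists s.
  pose V x := [set sval a x | a in A].
  have lbV x : lbound (V x) (- p (- x)).
    move=> _ [a Aa <-]; case: (svalP a) => sa ap.
    by apply: le_trans (sublinear_oppr x sa); rewrite lerN2.
  have V0 x : V x !=set0 by exists (sval a0 x), a0.
  pose h x := inf (V x).
  have hle a x : A a -> h x <= sval a x.
    by move=> Aa; apply: ge_inf; [exists (- p (- x))|exists a].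
  have sh : sublinear h.
    split.
      move=> x y; rewrite -lerBlDr; apply: lb_le_inf => // _ [a Aa <-].
      rewrite lerBlDr -lerBlDl; apply: lb_le_inf => // _ [b Ab <-].
      rewrite lerBlDl; have [sa _] := svalP a; have [sb _] := svalP b.
      have [/asboolP ab|/asboolP ba] := Atot _ _ Aa Ab.
        by have := hle _ (x + y) Ab; have := sb.1 x y; have := ab x; lra.
      by have := hle _ (x + y) Aa; have := sa.1 x y; have := ba y; lra.
    move=> a x; rewrite le_eqVlt => /orP[/eqP <-|a_gt0].
      rewrite scale0r mul0r; apply: le_trans (hle _ _ Aa0) _.
      by rewrite sublinear0//; case: (svalP a0).
    rewrite -ler_pdivrMl//; apply: lb_le_inf => // _ [b Ab <-].
    rewrite ler_pdivrMl//; apply: le_trans (hle _ _ Ab) _.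
    by have [sb _] := svalP b; exact: (sb.2 _ _ (ltW a_gt0)).
  have hp x : h x <= p x by apply: le_trans (hle _ _ Aa0) _; case: (svalP a0).
  by exists (exist _ h (conj sh hp)) => s As; apply/asboolP => x /=; exact: hle.
- exists q; split => // s ss sq'.
  have sp' x : s x <= p x by exact: le_trans (sq' x) (qp x).
  have /= := qm (exist _ s (conj ss sp')).
  by move=> /(_ _)/(congr1 sval)/=; apply; exact/asboolP.
Qed.

(* A minimal sublinear functional agrees with each of its shavings, hence is
   odd. *)
Lemma hahn_banach_norming p y : sublinear p ->
  exists q, [/\ real_linear q, (forall x, q x <= p x) & q y = p y].
Proof.
move=> sp.
(* Minimality is taken below the shaving of [p] at [y], not below [p]: this forces q (- y) <= - p y,
   hence q y = p y. *)
have [q [sq qp qm]] := minimal_sublinear (shave_sublinear y sp).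
have qN x : q (- x) = - q x.
  have /(congr1 (fun f => f (- x))) qx :=
    qm _ (shave_sublinear x sq) (fun z => shave_le_self x z sq).
  apply/eqP; rewrite eq_le; apply/andP; split.
    by rewrite -qx; exact: shave_opp.
  by rewrite lerNl; exact: sublinear_oppr.
have qD x z : q (x + z) = q x + q z.
  apply/eqP; rewrite eq_le sq.1 /=.
  have := sq.1 (x + z) (- z); rewrite addrK qN; lra.
have qZp a x : 0 <= a -> q (a *: x) = a * q x.
  move=> a0; apply/eqP; rewrite eq_le (sq.2 _ _ a0)/=.
  by have := sq.2 a (- x) a0; rewrite scalerN !qN mulrN lerN2.
exists q; split.
- move=> a x z; rewrite qD; congr (_ + _).
  have [/qZp//|a0] := leP 0 a.
  have /(qZp _ x) : 0 <= - a by rewrite oppr_ge0 ltW.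
  by rewrite scaleNr qN mulNr => /oppr_inj.
- by move=> x; apply: le_trans (qp x) _; exact: shave_le_self.
- apply/eqP; rewrite eq_le; apply/andP; split.
    by apply: le_trans (qp y) _; exact: shave_le_self.
  by have := le_trans (qp (- y)) (shave_opp y sp); rewrite qN lerN2.
Qed.

End hahn_banach.

(** * Ramsey's theorem *)

Section ramsey.
Implicit Types (A M : set nat) (P : seq nat -> Prop) (s t : seq nat).

Definition unbounded M : Prop := forall n, exists2 m, M m & (n < m)%N.

Definition increasing_in M s : Prop := sorted ltn s /\ {in s, forall n, M n}.

Definition homogeneous P (r : nat) M : Prop :=
  (forall s, size s = r -> increasing_in M s -> P s) \/
  (forall s, size s = r -> increasing_in M s -> ~ P s).

Lemma increasing_inS M A s : M `<=` A -> increasing_in M s -> increasing_in A s.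
Proof. by move=> MA [ss sM]; split => // n /sM/MA. Qed.

Lemma increasing_in_cons M n s : increasing_in M (n :: s) ->
  [/\ M n, increasing_in M s & {in s, forall m, (n < m)%N}].
Proof.
move=> [] /= ns nsM; split.
- by apply: nsM; rewrite inE eqxx.
- split; first exact: path_sorted ns.
  by move=> m ms; apply: nsM; rewrite inE ms orbT.
- by move: ns; rewrite (path_sortedE ltn_trans) => /andP[/allP].
Qed.

Lemma unboundedI_gt M n : unbounded M -> unbounded (M `&` [set m | (n < m)%N]).
Proof.
move=> Mu k; have [m Mm km] := Mu (maxn n k).
by move: km; rewrite gtn_max => /andP[nm km]; exists m.
Qed.

Lemma unboundedS M A : M `<=` A -> unbounded M -> unbounded A.
Proof. by move=> MA Mu n; have [m /MA] := Mu n; exists m. Qed.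

Lemma unboundedU M A : unbounded (M `|` A) -> unbounded M \/ unbounded A.
Proof.
move=> u; apply: contrapT => /not_orP[].
move=> /existsNP[n hn] /existsNP[k hk].
have [m mMA] := u (maxn n k); rewrite gtn_max => /andP[nm km].
by case: mMA => mM; [apply: hn; exists m|apply: hk; exists m].
Qed.

Lemma unbounded_infinite M : unbounded M -> infinite_set M.
Proof.
move=> Mu /finite_seqP[s Ms]; have [m] := Mu (\max_(i <- s) i)%N.
rewrite Ms /= => ms; apply/negP; rewrite -leqNgt.
exact: (@leq_bigmax_seq _ _ xpredT (fun i => i)). 
Qed.

Lemma unboundedNfinite M : ~ unbounded M -> finite_set M.
Proof.
move=> /existsNP[n hn]; apply: (sub_finite_set _ (finite_II n.+1)) => m Mm /=.
by rewrite ltnS leqNgt; apply/negP => nm; apply: hn; exists m.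
Qed.

Lemma strictly_increasingP (f : nat -> nat) :
  (forall n, (f n < f n.+1)%N) -> strictly_increasing f.
Proof. by move=> fS; apply: homo_ltn => // y x z; exact: ltn_trans. Qed.

Lemma strictly_increasing_le (f : nat -> nat) m n :
  strictly_increasing f -> (m <= n)%N -> (f m <= f n)%N.
Proof.
by move=> fi; rewrite leq_eqVlt => /orP[/eqP ->//|/fi/ltnW].
Qed.

Lemma strictly_increasing_ge (f : nat -> nat) n : strictly_increasing f -> (n <= f n)%N.
Proof.
move=> fi; elim: n => // n IHn; exact: leq_ltn_trans IHn (fi _ _ (ltnSn n)).
Qed.

Lemma strictly_increasing_inj (f : nat -> nat) : strictly_increasing f -> injective f.
Proof. by move=> fi m n fmn; case: (ltngtP m n) => // /fi; rewrite fmn ltnn. Qed.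

Lemma unbounded_eta M : unbounded M -> exists e, is_eta M e.
Proof.
move=> Mu.
have nxt n : {m | [/\ M m, (n <= m)%N & forall k, M k -> (n <= k)%N -> (m <= k)%N]}.
  apply: cid; have ex : exists m, `[< M m /\ (n <= m)%N >].
    by have [m Mm nm] := Mu n; exists m; apply/asboolP; split => //; exact: ltnW.
  case: (ex_minnP ex) => m /asboolP[Mm nm] mmin; exists m; split => // k Mk nk.
  by apply: mmin; apply/asboolP.
pose g n := sval (nxt n).
have gP n : [/\ M (g n), (n <= g n)%N & forall k, M k -> (n <= k)%N -> (g n <= k)%N].
  by rewrite /g; case: (nxt n).
pose e := fix e n := if n is k.+1 then g (e k).+1 else g 0%N.
have einc : strictly_increasing e.
  by apply: strictly_increasingP => n /=; case: (gP (e n).+1).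
exists e; split => //; apply/seteqP; split.
  by move=> _ [[|n] _ <-] /=; [case: (gP 0%N)|case: (gP (e n).+1)].
move=> m Mm.
have [|n men nmin] := @ex_minnP (fun n => m <= e n)%N.
  by exists m; exact: strictly_increasing_ge.
exists n => //; apply/eqP; rewrite eqn_leq men andbT.
case: n men nmin => [|n] men nmin /=.
  by have [_ _] := gP 0%N; exact.
have [_ _] := gP (e n).+1; apply => //; rewrite ltnNge; apply/negP => /nmin.
by rewrite ltnn.
Qed.

(** Induction on [r]: choose points [a n] and shrinking sets [B n] such that all tuples starting at
    [a n] and continuing in [B n] have the same colour, then apply the pigeonhole principle to these
    colours. *)
Theorem ramsey P r A : unbounded A ->
  exists M, [/\ M `<=` A, unbounded M & homogeneous P r M].
Proof.
elim: r => [|r IHr] in P A *.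
  move=> Au; exists A; split => //.
  have [p|np] := pselect (P [::]).
    by left => s /size0nil ->.
  by right => s /size0nil ->.
move=> Au.
pose good (p : nat * set nat) := [/\ unbounded p.2, p.2 `<=` [set m | (p.1 < m)%N]
  & homogeneous (P \o cons p.1) r p.2].
have step a B : unbounded B -> exists B', good (a, B') /\ B' `<=` B.
  move=> Bu; have [B' [B'B B'u hB']] := IHr (P \o cons a) _ (unboundedI_gt a Bu).
  by exists B'; split; [split => // m /B'B[]|move=> m /B'B[]].
have [a0 Aa0 _] := Au 0%N.
have [B0 [g0 B0A]] := step a0 A Au.
pose S := {p : nat * set nat | good p}.
pose R (p q : S) := (sval p).2 (sval q).1 /\ (sval q).2 `<=` (sval p).2.
have [p|f [f0 fS]] := @dependent_choice S R _ (exist _ _ g0).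
  apply: cid; case: p => [[a B] [/= Bu aB hB]].
  have [b Bb _] := Bu 0%N.
  by have [B' [gB' B'B]] := step b B Bu; exists (exist _ _ gB').
pose a n := (sval (f n)).1; pose B n := (sval (f n)).2.
have BS n m : (n <= m)%N -> B m `<=` B n.
  move=> /subnK <-; elim: (m - n)%N => // k IHk x Bx.
  by apply: IHk; apply: (fS _).2.
have aB n m : (n < m)%N -> B n (a m).
  by case: m => // m nm; apply: (BS n m) => //; exact: (fS m).1.
have ainc : strictly_increasing a.
  by move=> n m nm; have := aB _ _ nm; rewrite /a /B; case: (svalP (f n)) => _ + _; exact.
have aA n : A (a n).
  case: n => [|n]; first by rewrite /a f0.
  by apply: B0A; have := aB 0%N n.+1 isT; rewrite /B f0.
pose C b := [set n | `[< forall s, size s = r -> increasing_in (B n) s -> P (a n :: s) >] = b].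
have hom b : unbounded (C b) -> exists M, [/\ M `<=` A, unbounded M & homogeneous P r.+1 M].
  move=> Cu; exists (a @` C b); split.
  - by move=> _ [n _ <-].
  - move=> n; have [m Cm nm] := Cu n; exists (a m); first by exists m.
    exact: leq_trans nm (strictly_increasing_ge _ ainc).
  have key s : size s = r.+1 -> increasing_in (a @` C b) s -> exists n t,
      [/\ s = a n :: t, size t = r, C b n & increasing_in (B n) t].
    case: s => // x t [st] /increasing_in_cons[[n Cn <-] [tsort tC] xt].
    exists n, t; split => //; split => // y yt.
    have [m _ ym] := tC y yt; rewrite -ym; apply: aB.
    rewrite ltnNge; apply/negP => /(strictly_increasing_le ainc).
    by rewrite leqNgt ym xt.
  case: b Cu key => Cu key; [left|right] => s ss si; have [n [t [-> st Cn ti]]] := key s ss si.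
    by move: Cn => /asboolP; exact.
  (* Not all tuples have the property, so by homogeneity of [B n] none has it. *)
  move: Cn => /= /asboolP nh.
  have [_ _ [h|h]] := svalP (f n); last exact: h.
  by exfalso; apply: nh => u su ui; exact: h.
have [|/hom//|/hom//] := @unboundedU (C true) (C false).
by move=> n; exists n.+1 => //; rewrite /C /=; case: asbool; [left|right].
Qed.

End ramsey.

(** * Diagonal intersection of shrinking sets *)

Section diagonal.

(** [M] is a pseudo-intersection of shrinking sets [B k]; only its part after [a k] lies in [B k].
    It provides one set that is homogeneous for tuples of every length, far enough out. *)
Lemma diagonal_unbounded (Q : nat -> set nat -> Prop) (A : set nat) :
  (forall k (M M' : set nat), M' `<=` M -> Q k M -> Q k M') ->
  (forall k (B : set nat), unbounded B -> exists M, [/\ M `<=` B, unbounded M & Q k M]) ->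
  unbounded A ->
  exists M, [/\ M `<=` A, unbounded M & forall k, exists n, Q k (M `&` [set m | (n < m)%N])].
Proof.
move=> Qh Qex Au.
pose good (p : nat * (nat * set nat)) :=
  [/\ unbounded p.2.2, p.2.2 `<=` A, A p.2.1 & Q p.1 p.2.2].
pose S := {p : nat * (nat * set nat) | good p}.
pose R (p q : S) := [/\ (sval q).1 = (sval p).1.+1, (sval p).2.2 (sval q).2.1,
  ((sval p).2.1 < (sval q).2.1)%N & (sval q).2.2 `<=` (sval p).2.2].
have [a0 Aa0 _] := Au 0%N.
have [B0 [B0A B0u QB0]] := Qex 0%N A Au.
have g0 : good (0%N, (a0, B0)) by [].
have [p|f [f0 fS]] := @dependent_choice S R _ (exist _ _ g0).
  apply: cid; case: p => [[k [a B]] [/= Bu BA Aa QB]].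
  have [b Bb ab] := Bu a; have [M [MB Mu QM]] := Qex k.+1 B Bu.
  have gM : good (k.+1, (b, M)) by split => //=; [exact: subset_trans MB BA|exact: BA].
  by exists (exist _ _ gM).
pose a n := (sval (f n)).2.1; pose B n := (sval (f n)).2.2.
have fn n : (sval (f n)).1 = n.
  by elim: n => [|n IHn]; [rewrite f0|have [-> _ _ _] := fS n; rewrite IHn].
have ainc : strictly_increasing a.
  by apply: strictly_increasingP => n; case: (fS n).
have BS n m : (n <= m)%N -> B m `<=` B n.
  move=> /subnK <-; elim: (m - n)%N => // k IHk x Bx.
  by apply: IHk; case: (fS (k + n)%N) => _ _ _; apply.
have aB n m : (n < m)%N -> B n (a m).
  by case: m => // m nm; apply: (BS n m) => //; case: (fS m).
exists (range a); split.
- by move=> _ [n _ <-]; rewrite /a; case: (svalP (f n)).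
- move=> n; exists (a n.+1); first by exists n.+1.
  exact: strictly_increasing_ge.
- move=> k; exists (a k); apply: (Qh k (B k)).
    move=> _ [[n _ <-] /= an]; apply: aB; rewrite ltnNge.
    by apply/negP => /(strictly_increasing_le ainc); rewrite leqNgt an.
  by rewrite /B -[X in Q X _](fn k); case: (svalP (f k)).
Qed.

End diagonal.

(** * Functionals on an infinite-dimensional real normed space *)

Section normed.
Variables (R : realType) (X : lmodType R) (N : X -> R).
Hypothesis ND : forall x y, N (x + y) <= N x + N y.
Hypothesis NZ : forall a x, N (a *: x) = `|a| * N x.
Implicit Types (u v : X -> R) (x y z : X) (phi psi : nat -> X -> R) (s t : seq nat).

Definition dual u : Prop :=
  real_linear u /\ exists C : R, forall x, u x <= C * N x.

(* The norm of u is at least a; unlike for a supremum, a point witnesses it. *)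
Definition big u (a : R) : Prop := exists2 x, N x <= 1 & a <= u x.

Lemma real_linearD u x y : real_linear u -> u (x + y) = u x + u y.
Proof. by move=> /(_ 1 x y); rewrite scale1r mul1r. Qed.

Lemma real_linear0 u : real_linear u -> u 0 = 0.
Proof. by move=> ul; have := real_linearD 0 0 ul; rewrite addr0; lra. Qed.

Lemma real_linearZ u a x : real_linear u -> u (a *: x) = a * u x.
Proof. by move=> ul; rewrite -[a *: x]addr0 ul (real_linear0 ul) addr0. Qed.

Lemma real_linearN u x : real_linear u -> u (- x) = - u x.
Proof. by move=> ul; rewrite -scaleN1r real_linearZ// mulN1r. Qed.

Lemma N_opp x : N (- x) = N x.
Proof. by rewrite -scaleN1r NZ normrN1 mul1r. Qed.

Lemma N_zero : N 0 = 0.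
Proof. by rewrite -(scale0r 0) NZ normr0 mul0r. Qed.

Lemma N_ge0 x : 0 <= N x.
Proof. by have := ND x (- x); rewrite subrr N_zero N_opp; lra. Qed.

Lemma N_sublinear : sublinear N.
Proof. by split=> // a x a0; rewrite NZ ger0_norm. Qed.

Lemma dual_norm u : dual u -> exists2 C : R, 0 <= C & forall x, `|u x| <= C * N x.
Proof.
move=> [ul [C uC]]; exists `|C|; first exact: normr_ge0.
have uC' x : u x <= `|C| * N x.
  by apply: le_trans (uC x) _; rewrite ler_wpM2r// ?N_ge0// ler_norm.
by move=> x; rewrite ler_norml uC' andbT lerNl -real_linearN// -(N_opp x).
Qed.

Lemma dualP u C : real_linear u -> (forall x, u x <= C * N x) -> dual u.
Proof. by move=> ul uC; split => //; exists C. Qed.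

Lemma dual_le u x : real_linear u -> (forall x, u x <= N x) -> `|u x| <= N x.
Proof.
by move=> ul uN; rewrite ler_norml uN andbT lerNl -real_linearN// -(N_opp x).
Qed.

Lemma dualD u v : dual u -> dual v -> dual (fun x => u x + v x).
Proof.
move=> [ul [C uC]] [vl [D vD]]; split.
  by move=> a x y; rewrite ul vl mulrDr addrACA.
by exists (C + D) => x; rewrite mulrDl lerD.
Qed.

Lemma dualZ a u : dual u -> dual (fun x => a * u x).
Proof.
move=> du; have [C C0 uC] := dual_norm du; case: du => ul _; split.
  by move=> b x y; rewrite ul; ring.
exists (`|a| * C) => x; apply: le_trans (ler_norm _) _.
by rewrite normrM -mulrA ler_wpM2l.
Qed.

Lemma dualN u : dual u -> dual (fun x => - u x).
Proof.
by move=> /(dualZ (-1)); congr dual; apply/funext => x; rewrite mulN1r.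
Qed.

Lemma dualB u v : dual u -> dual v -> dual (fun x => u x - v x).
Proof. by move=> du /dualN dv; exact: dualD. Qed.

Lemma dual0 : dual (fun=> 0).
Proof.
split; first by move=> a x y; rewrite mulr0 addr0.
by exists 0 => x; rewrite mul0r.
Qed.

Lemma dual_sum s phi : (forall n, dual (phi n)) -> dual (fun x => \sum_(n <- s) phi n x).
Proof.
move=> dphi; elim: s => [|n s IHs].
  by under eq_fun do rewrite big_nil; exact: dual0.
by under eq_fun do rewrite big_cons; exact: dualD.
Qed.

Lemma big_scale u a b : 0 < b -> big u a -> big (fun x => b * u x) (b * a).
Proof. by move=> b0 [x x1 ux]; exists x => //; rewrite ler_pM2l. Qed.

(** Used contrapositively: in infinite dimension a finite list of functionals has a common nonzero
    zero. The subspace [V] is there for the induction, which passes to the kernel of the head and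
    adds one vector to the family. *)
Lemma common_kernel_span (us : seq (X -> R)) (V : set X) :
  all (fun u => `[< real_linear u >]) us ->
  (forall a x y, V x -> V y -> V (a *: x + y)) ->
  (forall x, V x -> all (fun u => u x == 0) us -> x = 0) ->
  exists (n : nat) (e : 'I_n -> X),
    forall x, V x -> exists c : 'I_n -> R, x = \sum_(i < n) c i *: e i.
Proof.
elim: us V => [|u us IHus] V /=.
  move=> _ _ V0; exists 0%N, (fun=> 0) => x /V0 -> //.
  by exists (fun=> 0); rewrite big_ord0.
move=> /andP[/asboolP ul usl] VS V0.
have [uV|] := pselect (forall x, V x -> u x = 0).
  by apply: IHus => // x Vx xus; apply: V0 => //; rewrite uV// eqxx.
move=> /existsNP[y /not_implyP[Vy /eqP uy]].
have [||n [e ne]] := IHus (V `&` [set x | u x = 0]) usl.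
- move=> a x z [Vx /= ux] [Vz /= uz]; split; first exact: VS.
  by rewrite /= ul ux uz mulr0 addr0.
- by move=> x [Vx /= ux] xus; apply: V0 => //; rewrite ux eqxx.
exists n.+1, (fun i => oapp e y (unlift ord0 i)) => x Vx.
have [|c xc] := ne (- (u x / u y) *: y + x).
  split; first exact: VS.
  by rewrite /= ul mulNr -mulrA mulVf// mulr1 addNr.
exists (fun i => oapp c (u x / u y) (unlift ord0 i)).
rewrite big_ord_recl unlift_none /=.
under eq_bigr do rewrite liftK /=.
by rewrite -xc scaleNr addrA subrr add0r.
Qed.

Hypothesis N0 : forall x, N x = 0 -> x = 0.

(** Take a unit vector killed by all earlier functionals and a functional of norm one with value - 1
    there: its difference with an earlier one is 1 at that vector. *)
Lemma separated_sequence :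
  ~ (exists (n : nat) (e : 'I_n -> X),
      forall x, exists c : 'I_n -> R, x = \sum_(i < n) c i *: e i) ->
  exists phi, [/\ forall n, real_linear (phi n), forall n x, phi n x <= N x &
    forall i j, (i < j)%N -> big (fun x => phi i x - phi j x) 1].
Proof.
move=> infX.
(* The hypothesis on [us] sits inside the specification, so the choice is total and [L] can be
   defined by plain recursion. *)
have ext (us : seq (X -> R)) : {v | all (fun u => `[< real_linear u >]) us ->
    [/\ real_linear v, forall x, v x <= N x &
        exists y, [/\ N y = 1, v y = -1 & all (fun u => u y == 0) us]]}.
  apply: cid; have [usl|nusl] := boolP (all (fun u => `[< real_linear u >]) us); last first.
    by exists (fun=> 0).
  have [y [y0 yus]] : exists y, y != 0 /\ all (fun u => u y == 0) us.
    apply: contrapT => h; apply: infX.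
    have [//||n [e he]] := @common_kernel_span us setT usl; last first.
      by exists n, e => x; exact: he.
    move=> x _ xus; apply: contrapT => /eqP x0; apply: h.
    by exists x.
  have Ny : N y != 0 by apply: contraNneq y0 => /N0 ->.
  pose z := (N y)^-1 *: y.
  have Nz : N z = 1 by rewrite NZ normfV ger0_norm ?N_ge0// mulVf.
  have [v [vl vN vz]] := hahn_banach_norming (- z) N_sublinear.
  exists v => _; split => //; exists z; split => //.
    by apply/eqP; rewrite -eqr_oppLR -real_linearN// vz N_opp Nz.
  have : all (predI (fun u => `[< real_linear u >]) (fun u => u y == 0)) us.
    by rewrite all_predI usl yus.
  by apply: sub_all => u /= /andP[/asboolP ul /eqP uy]; rewrite real_linearZ// uy mulr0.
pose L := fix L n := if n is k.+1 then sval (ext (L k)) :: L k else [::].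
pose phi n := sval (ext (L n)).
have Llin n : all (fun u => `[< real_linear u >]) (L n).
  elim: n => //= n IHn; apply/andP; split => //; apply/asboolP.
  by case: (svalP (ext (L n)) IHn).
have phiP n := svalP (ext (L n)) (Llin n).
exists phi; split.
- by move=> n; case: (phiP n).
- by move=> n; case: (phiP n).
- move=> i j ij; have [_ _ [y [Ny phij yL]]] := phiP j.
  exists y; first by rewrite Ny.
  suff -> : phi i y = 0 by rewrite /phi phij sub0r opprK.
  elim: j ij yL {phij} => // j IHj; rewrite ltnS leq_eqVlt /= => /orP[/eqP ->|ij] /andP[/eqP hy yL] //.
  exact: IHj.
Qed.

(* A finitary form of the failure of weak* nullity. *)
Definition spread (c : R) : Prop := forall (h : nat) psi,
  (forall k, dual (psi k)) -> (forall k, big (psi k) 1) ->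
  exists x s, [/\ N x <= 1, size s = h, sorted ltn s & {in s, forall k, c <= psi k x}].

Lemma spread_scale (c a : R) h psi : spread c -> 0 < a ->
  (forall k, dual (psi k)) -> (forall k, big (psi k) a) ->
  exists x s, [/\ N x <= 1, size s = h, sorted ltn s & {in s, forall k, a * c <= psi k x}].
Proof.
move=> sc a0 dpsi bpsi.
have [|k|x [s [x1 sh ss sk]]] := sc h (fun k x => a^-1 * psi k x).
- by move=> k; exact: dualZ.
- by have := big_scale (_ : 0 < a^-1) (bpsi k); rewrite invr_gt0 mulVf ?gt_eqF//; exact.
exists x, s; split => // k /sk hk; have := ler_wpM2l (ltW a0) hk; rewrite mulVKf ?gt_eqF//.
Qed.

(** * Block sums, Rademacher sums and the Bessel inequality *)

Definition block phi s x : R := \sum_(n <- s) phi n x.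

Lemma block_cat phi s t x : block phi (s ++ t) x = block phi s x + block phi t x.
Proof. by rewrite /block big_cat. Qed.

Lemma sorted_map_incr (e : nat -> nat) s : strictly_increasing e -> sorted ltn s ->
  sorted ltn (map e s).
Proof. by move=> ei; rewrite sorted_map; apply: sub_sorted => m n /=; exact: ei. Qed.

Lemma sorted_cat s t : sorted ltn s -> sorted ltn t ->
  (forall m n, m \in s -> n \in t -> (m < n)%N) -> sorted ltn (s ++ t).
Proof.
rewrite !(sorted_pairwise ltn_trans) pairwise_cat => -> -> h.
by rewrite /= andbT; apply/allrelP.
Qed.

Lemma sum_ge_const (a : R) (f : nat -> R) s : {in s, forall n, a <= f n} ->
  a * (size s)%:R <= \sum_(n <- s) f n.
Proof.
elim: s => [|n s IHs] h; first by rewrite mulr0 big_nil.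
rewrite big_cons /= mulrS mulrDr mulr1 lerD ?h ?inE ?eqxx//.
by apply: IHs => k ks; rewrite h// inE ks orbT.
Qed.

(* If all the differences of two successive blocks of length m were small,
   comparing two interleaved blocks with a common later one would make
   sums of m positive differences small. *)
Lemma block_large (c : R) phi m (A : set nat) : 0 < c -> spread c ->
  (forall n, dual (phi n)) ->
  (forall i j, (i < j)%N -> big (fun x => phi i x - phi j x) 1) ->
  (0 < m)%N -> unbounded A ->
  exists M, [/\ M `<=` A, unbounded M & forall s t, size s = m -> size t = m ->
    increasing_in M (s ++ t) ->
    big (fun x => block phi s x - block phi t x) (c / 4 * m%:R)].
Proof.
move=> c0 sc dphi sphi m0 Au.
pose P r := big (fun x => block phi (take m r) x - block phi (drop m r) x) (c / 4 * m%:R).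
have [M [MA Mu [hM|hM]]] := ramsey P (m + m) Au; exists M; split => // s t sm tm stM.
  by have := hM (s ++ t); rewrite /P take_size_cat// drop_size_cat// size_cat sm tm; exact.
exfalso.
have [e [einc eM]] := unbounded_eta Mu.
have Me n : M (e n) by rewrite -eM; exists n.
(* The pairs are disjoint, so the even and the odd members chosen by [D] each form a block. *)
have [|k|x [D [x1 Dm Ds Dk]]] := sc m (fun k x => phi (e k.*2) x - phi (e k.*2.+1) x).
- by move=> k; exact: dualB.
- exact/sphi/einc.
pose K := (\max_(i <- D) i)%N.
(* A block beyond all indices in play, with which both the even and the odd block are compared. *)
pose u := map e (iota K.*2.+2 m).
have small (v : seq nat) b : size v = m -> sorted ltn v -> (forall n, n \in v -> (n <= K.*2.+1)%N) ->
    N b <= 1 -> block phi (map e v) b - block phi u b < c / 4 * m%:R.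
  move=> vm vs vK b1; rewrite ltNge; apply/negP => le.
  apply: (hM (map e v ++ u)).
  - by rewrite size_cat !size_map size_iota vm.
  - split; last first.
      by move=> n; rewrite mem_cat => /orP[] /mapP[i _ ->].
    rewrite -map_cat; apply: sorted_map_incr => //; apply: sorted_cat => //.
      exact: iota_ltn_sorted.
    move=> i j /vK iK; rewrite mem_iota => /andP[Kj _].
    exact: leq_ltn_trans iK Kj.
  - rewrite /P take_size_cat ?size_map// drop_size_cat ?size_map//.
    by exists b.
have DK n : n \in D -> (n <= K)%N by move=> nD; exact: (@leq_bigmax_seq _ _ xpredT (fun i => i)).
have := small (map double D) x; rewrite size_map Dm => /(_ erefl) h1.
have {h1} := h1 _ _ x1; have := small (map (fun n => n.*2.+1) D) (- x).
rewrite size_map Dm N_opp => /(_ erefl) h2; have {h2} := h2 _ _ x1.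
move=> h2 h1.
have {}h1 : block phi (map e (map double D)) x - block phi u x < c / 4 * m%:R.
  apply: h1; first by rewrite sorted_map; apply: sub_sorted Ds => a b /=; rewrite ltn_double.
  by move=> n /mapP[i /DK iK ->]; rewrite ltnW// ltnS leq_double.
have {h2} : block phi (map e (map (fun n => n.*2.+1) D)) (- x) - block phi u (- x) < c / 4 * m%:R.
  apply: h2; first by rewrite sorted_map; apply: sub_sorted Ds => a b /=; rewrite ltnS ltn_double.
  by move=> n /mapP[i /DK iK ->]; rewrite ltnS leq_double.
have blockN (v : seq nat) : block phi v (- x) = - block phi v x.
  by rewrite /block -sumrN; apply: eq_bigr => i _; rewrite real_linearN//; case: (dphi i).
rewrite !blockN.
(* The two bounds, at [x] and at [- x], add up to less than c / 2 * m, as [u] cancels; hence the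
   constant c / 4. *)
have : c * m%:R <= block phi (map e (map double D)) x - block phi (map e (map (fun n => n.*2.+1) D)) x.
  rewrite /block !big_map -sumrB -Dm; exact: sum_ge_const.
have : 0 < c * m%:R by rewrite mulr_gt0// ltr0n.
lra.
Qed.


(* Rademacher sums over a list of 2 ^ m functionals; the sign of the entry at
   position p in the i-th sum is given by the i-th binary digit of p. *)
Fixpoint rad phi (m i : nat) s x : R :=
  if m is k.+1 then
    let s1 := take (2 ^ k) s in let s2 := drop (2 ^ k) s in
    if i == k then block phi s1 x - block phi s2 x
    else rad phi k i s1 x + rad phi k i s2 x
  else 0.

Lemma rad_cat phi m i s t x : size s = (2 ^ m)%N ->
  rad phi m.+1 i (s ++ t) x =
  if i == m then block phi s x - block phi t x else rad phi m i s x + rad phi m i t x.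
Proof. by move=> sm /=; rewrite take_size_cat// drop_size_cat. Qed.

Lemma dual_block phi s : (forall n, dual (phi n)) -> dual (block phi s).
Proof. exact: dual_sum. Qed.

Lemma dual_rad phi m i s : (forall n, dual (phi n)) -> dual (rad phi m i s).
Proof.
move=> dphi; elim: m s => [|m IHm] s /=; first exact: dual0.
case: (i == m); first by apply: dualB; exact: dual_block.
exact: dualD.
Qed.

(** The sign vectors are orthogonal. [block], the sum with constant signs, is included so that the
    induction closes: with the new Rademacher sum it satisfies the parallelogram identity, and the
    older sums satisfy (a + b)^2 <= 2 a^2 + 2 b^2. *)
Lemma bessel_rad phi m s x (C : R) : size s = (2 ^ m)%N -> (forall n, `|phi n x| <= C) ->
  block phi s x ^+ 2 + \sum_(i < m) rad phi m i s x ^+ 2 <= (2 ^+ m * C) ^+ 2.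
Proof.
move=> sm phiC; elim: m s sm => [|m IHm] s sm.
  case: s sm => // n [|//] _; rewrite big_ord0 addr0 expr0 mul1r /block big_seq1.
  by rewrite -(real_normK (num_real _)) lerXn2r// nnegrE (le_trans _ (phiC n)).
have [s1 [s2 [s1m s2m ->]]] : exists s1 s2,
    [/\ size s1 = (2 ^ m)%N, size s2 = (2 ^ m)%N & s = s1 ++ s2].
  exists (take (2 ^ m) s), (drop (2 ^ m) s); rewrite cat_take_drop size_drop size_take sm.
  by rewrite expnS; split=> //; [rewrite ltn_Pmull ?expn_gt0|rewrite mul2n -addnn addnK].
rewrite big_ord_recr /= take_size_cat// drop_size_cat// eqxx block_cat.
have h (i : 'I_m) : (if i == m :> nat then block phi s1 x - block phi s2 x
    else rad phi m i s1 x + rad phi m i s2 x) ^+ 2 <=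
    2 * rad phi m i s1 x ^+ 2 + 2 * rad phi m i s2 x ^+ 2.
  rewrite (ltn_eqF (ltn_ord i)).
  by have := sqr_ge0 (rad phi m i s1 x - rad phi m i s2 x); lra.
have := ler_sum (index_enum 'I_m) (fun i (_ : true) => h i).
rewrite big_split /= -!mulr_sumr.
have := IHm _ s1m; have := IHm _ s2m.
set a := \sum_(i < m) _; set b := \sum_(i < m) _; set d := \sum_(i < m) _.
have -> : (2 ^+ m.+1 * C) ^+ 2 = 4 * (2 ^+ m * C) ^+ 2 by rewrite (exprS 2 m); ring.
move: (2 ^+ m * C) => P; lra.
Qed.

Lemma increasing_in_cat (M : set nat) s t : increasing_in M (s ++ t) <->
  [/\ increasing_in M s, increasing_in M t & forall i j, i \in s -> j \in t -> (i < j)%N].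
Proof.
split.
  move=> [sst stM]; move: (sst); rewrite (sorted_pairwise ltn_trans) pairwise_cat.
  move=> /and3P[/allrelP st s_ t_]; split => //.
  - by split; [rewrite (sorted_pairwise ltn_trans)|move=> n ns; apply: stM; rewrite mem_cat ns].
  - by split; [rewrite (sorted_pairwise ltn_trans)|move=> n ns; apply: stM; rewrite mem_cat ns orbT].
move=> [[s1 s2] [t1 t2] st]; split; first exact: sorted_cat.
by move=> n; rewrite mem_cat => /orP[/s2|/t2].
Qed.

(** Successive chunks of length 2 ^ m; the condition on [t i ++ t j] also makes each chunk
    increasing. *)
Definition tree_level (M : set nat) m (t : nat -> seq nat) : Prop :=
  (forall j, size (t j) = (2 ^ m)%N) /\
  (forall i j, (i < j)%N -> increasing_in M (t i ++ t j)).

Lemma tree_level_ge (M : set nat) m (t : nat -> seq nat) j n : tree_level M m t -> n \in t j -> (j <= n)%N.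
Proof.
move=> [tm tM]; elim: j n => // j IHj n nt.
have : (0 < size (t j))%N by rewrite tm expn_gt0.
case: (t j) (tM j j.+1 (ltnSn j)) IHj => // k s ks IHj _.
have /increasing_in_cat[_ _] := ks; move=> /(_ k n); rewrite inE eqxx => /(_ isT nt).
by apply: leq_ltn_trans; apply: IHj; rewrite inE eqxx.
Qed.

(** The thinning [a] lets the next level keep only those pairs of chunks on which a chosen point is
    large. *)
Lemma tree_level_double (M : set nat) m (t : nat -> seq nat) (a : nat -> nat) : tree_level M m t ->
  strictly_increasing a ->
  tree_level M m.+1 (fun j => t (a j).*2 ++ t (a j).*2.+1).
Proof.
move=> [tm tM] ainc; split; first by move=> j; rewrite size_cat !tm expnS mul2n addnn.
move=> i j /ainc aij.
have lt2 : ((a i).*2.+1 < (a j).*2)%N by lia.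
have /increasing_in_cat[i1 j1 h1] := tM _ _ (ltnSn (a i).*2).
have /increasing_in_cat[i2 j2 h2] := tM _ _ (ltnSn (a j).*2).
have /increasing_in_cat[_ _ h3] := tM _ _ lt2.
have /increasing_in_cat[_ _ h4] := tM _ _ (ltn_trans lt2 (ltnSn _)).
have /increasing_in_cat[_ _ h5] := tM _ _ (ltn_trans (ltnSn _) lt2).
have /increasing_in_cat[_ _ h6] := tM _ _ (ltn_trans (ltn_trans (ltnSn _) lt2) (ltnSn _)).
apply/increasing_in_cat; split; try exact: tM.
move=> k l; rewrite !mem_cat => /orP[]k_ /orP[]l_; eauto.
Qed.

Lemma rad_ge phi m i s x : (m <= i)%N -> rad phi m i s x = 0.
Proof.
elim: m s => // m IHm s mi /=; rewrite gtn_eqF//.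
by rewrite !IHm ?addr0// ltnW.
Qed.

(** Stronger than [spread]: one point serves infinitely many functionals, so that the tree
    construction can go on with what is left. *)
Definition spread_unbounded (c : R) : Prop := forall psi,
  (forall k, dual (psi k)) -> (forall k, big (psi k) 1) ->
  exists2 x, N x <= 1 & unbounded [set k | c <= psi k x].

Lemma spread_unbounded_spread c : spread_unbounded c -> spread c.
Proof.
move=> sc h psi dpsi bpsi; have [x x1 xu] := sc psi dpsi bpsi.
have [e [einc eP]] := unbounded_eta xu.
exists x, (map e (iota 0 h)); split => //; first by rewrite size_map size_iota.
  by apply: sorted_map_incr => //; exact: iota_ltn_sorted.
move=> k /mapP[j _ ->]; suff : [set k | c <= psi k x] (e j) by [].
by rewrite -eP; exists j.
Qed.

Lemma spread_unbounded_scale (c a : R) psi : spread_unbounded c -> 0 < a ->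
  (forall k, dual (psi k)) -> (forall k, big (psi k) a) ->
  exists2 x, N x <= 1 & unbounded [set k | a * c <= psi k x].
Proof.
move=> sc a0 dpsi bpsi.
have [|k|x x1 xu] := sc (fun k x => a^-1 * psi k x).
- by move=> k; exact: dualZ.
- by have := big_scale (_ : 0 < a^-1) (bpsi k); rewrite invr_gt0 mulVf ?gt_eqF//; exact.
exists x => //; apply: unboundedS xu => k /= hk.
by have := ler_wpM2l (ltW a0) hk; rewrite mulVKf ?gt_eqF.
Qed.

Lemma sum_seq_le_ord (f : nat -> R) D k : sorted ltn D -> (forall i, 0 <= f i) ->
  {in D, forall i, (i < k)%N} -> \sum_(i <- D) f i <= \sum_(i < k) f i.
Proof.
move=> Ds f0 Dk; rewrite -(big_mkord xpredT f) /index_iota subn0.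
rewrite [leRHS](bigID (mem D)) /= -[leLHS]addr0 lerD ?sumr_ge0//.
rewrite -[leRHS]big_filter le_eqVlt (perm_big [seq i <- iota 0 k | i \in D]) ?eqxx//.
apply: uniq_perm.
- exact: sorted_uniq ltn_trans ltnn D Ds.
- by rewrite filter_uniq// iota_uniq.
- move=> i; rewrite mem_filter mem_iota /= add0n.
  by case: (boolP (i \in D)) => //= /Dk ->.
Qed.

(** At a point of the unit ball the Bessel bound allows at most (a * c) ^- 2 values of size a * c,
    whereas [spread] yields any number of them. *)
Lemma spread_bessel (c a : R) (f : nat -> X -> R) : 0 < c -> 0 < a -> spread c ->
  (forall i, dual (f i)) -> (forall i, big (f i) a) ->
  (forall k x, \sum_(i < k) f i x ^+ 2 <= N x ^+ 2) -> False.
Proof.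
move=> c0 a0 sc df bf bes.
have ac0 : 0 < (a * c) ^+ 2 by rewrite exprn_gt0// mulr_gt0.
pose h := (Num.trunc ((a * c) ^+ 2)^-1).+1.
have hh : 1 < (a * c) ^+ 2 * h%:R.
  by rewrite -ltr_pdivrMl// mulr1 truncnS_gt.
have [x [D [x1 Dh Ds Dk]]] := spread_scale h sc a0 df bf.
have : (a * c) ^+ 2 * h%:R <= 1.
  rewrite -Dh; apply: (@le_trans _ _ (\sum_(i <- D) f i x ^+ 2)).
    have ac : 0 <= a * c by rewrite mulr_ge0 ?ltW.
    by apply: sum_ge_const => i /Dk h'; rewrite lerXn2r ?nnegrE// (le_trans ac).
  apply: (@le_trans _ _ (\sum_(i < (\max_(i <- D) i).+1) f i x ^+ 2)).
    apply: (sum_seq_le_ord (f := fun i => f i x ^+ 2)) => // i; first exact: sqr_ge0.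
    by move=> iD; rewrite ltnS; exact: (@leq_bigmax_seq _ _ xpredT (fun i => i)).
  apply: le_trans (bes _ x) _.
  by rewrite expr_le1// N_ge0.
by rewrite leNgt hh.
Qed.

Hypothesis infX : ~ (exists (n : nat) (e : 'I_n -> X),
      forall x, exists c : 'I_n -> R, x = \sum_(i < n) c i *: e i).

(* A Rademacher tree of functionals is grown together with points x_i at which
   the i-th Rademacher average stays large along all later levels; the limits
   of these averages along an ultrafilter satisfy a Bessel inequality. *)
Theorem almost_null_sequence (c : R) : 0 < c -> exists psi,
  [/\ forall k, dual (psi k), forall k, big (psi k) 1 &
      forall x, N x <= 1 -> exists k0, forall k, (k0 <= k)%N -> `|psi k x| < c].
Proof.
move=> c0; apply: contrapT => hc.
(* A counterexample would eventually be below c both at [x] and at [- x], hence be one of the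
   sequences excluded by [hc]. *)
have sc : spread_unbounded c.
  move=> psi dpsi bpsi; apply: contrapT => hx; apply: hc; exists psi; split => // x x1.
  have bnd y : N y <= 1 -> exists n, forall k, (n < k)%N -> psi k y < c.
    move=> y1; have : ~ unbounded [set k | c <= psi k y] by move=> yu; apply: hx; exists y.
    move=> /existsNP[n hn]; exists n => k nk; rewrite ltNge; apply/negP => ck.
    by apply: hn; exists k.
  have [n hn] := bnd x x1; have [l hl] := bnd (- x) (etrans (congr1 (<=%R^~ 1) (N_opp x)) x1).
  exists (maxn n l).+1 => k; rewrite gtn_max => /andP[/hn h1 /hl].
  by rewrite (real_linearN _ (dpsi k).1) ltr_norml h1 andbT ltrNl.
have sc' := spread_unbounded_spread sc.
have [phi [phil phiN phis]] := separated_sequence infX.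
have dphi n : dual (phi n) by apply: (dualP (C := 1)) => // x; rewrite mul1r.
pose Q k (M : set nat) := forall s t, size s = (2 ^ k)%N -> size t = (2 ^ k)%N ->
  increasing_in M (s ++ t) ->
  big (fun x => block phi s x - block phi t x) (c / 4 * (2 ^ k)%:R).
have [k M M' M'M QM s t sk tk st|k B Bu||M [_ Mu MQ]] := @diagonal_unbounded Q setT.
- by apply: QM => //; exact: increasing_inS st.
- by apply: block_large => //; rewrite expn_gt0.
- by move=> n; exists n.+1.
(* One factor c / 4 comes from [block_large], one factor c from the choice of the point, and 1 / 2
   from the doubled length of the new chunks. *)
pose c1 := c * c / 8.
have c10 : 0 < c1 by rewrite /c1 divr_gt0 ?mulr_gt0.
pose inv m (p : (nat -> seq nat) * (nat -> X)) := tree_level M m p.1 /\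
  forall i, (i < m)%N -> N (p.2 i) <= 1 /\
    forall j, c1 * (2 ^ m)%:R <= rad phi m i (p.1 j) (p.2 i).
have base : {p | inv 0%N p}.
  apply: cid; have [e [einc eM]] := unbounded_eta Mu.
  exists (fun j => [:: e j], fun=> 0); split => //; split => // i j ij /=.
  split; first by rewrite /= einc.
  by move=> n; rewrite !inE => /orP[]/eqP ->; rewrite -eM; [exists i|exists j].
have step m (p : {p | inv m p}) :
    {q : {q | inv m.+1 q} | forall i, (i < m)%N -> (sval q).2 i = (sval p).2 i}.
  apply: cid; case: p => [[t xs] /= [tl tx]].
  have [n Qn] := MQ m; have [tm tM] := tl; rewrite /= in tm tM.
  (* Chunk number j has all its entries at least j, so the shift by n + 1 leads into the range where
     [Qn] holds. *)
  pose a j := t (j + n.+1).*2; pose b j := t (j + n.+1).*2.+1.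
  pose w := c / 4 * (2 ^ m)%:R.
  have w0 : 0 < w by rewrite mulr_gt0 ?divr_gt0// ltr0n expn_gt0.
  have [||x x1 xu] := @spread_unbounded_scale c w
      (fun j y => block phi (a j) y - block phi (b j) y) sc w0.
  - by move=> j; apply: dualB; exact: dual_block.
  - move=> j; apply: Qn; rewrite ?tm//.
    have [ss sM] := tM _ _ (ltnSn (j + n.+1).*2); split => // k kab.
    split; first exact: sM.
    move: kab; rewrite mem_cat => /orP[] /(tree_level_ge tl) /=; lia.
  have [e [einc eP]] := unbounded_eta xu.
  have eJ j : w * c <= block phi (a (e j)) x - block phi (b (e j)) x.
    by suff : [set k | w * c <= block phi (a k) x - block phi (b k) x] (e j); [|rewrite -eP; exists j].
  pose t' j := a (e j) ++ b (e j).
  pose xs' i := if i == m then x else xs i.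
  have inv' : inv m.+1 (t', xs').
    split; first by apply: (@tree_level_double M m t (fun j => e j + n.+1)%N) => // i j /einc; lia.
    move=> i; rewrite /xs' /t' /= ltnS leq_eqVlt => /orP[/eqP ->|im].
      rewrite eqxx; split => // j; rewrite take_size_cat ?tm// drop_size_cat ?tm//.
      apply: le_trans (eJ j); rewrite /w /c1 expnS natrM; lra.
    rewrite (ltn_eqF im); have [xi1 xi] := tx i im; split => // j.
    rewrite take_size_cat ?tm// drop_size_cat ?tm//.
    (* The older sums stay large because they are added over the two chunks while the bound
       doubles. *)
    have := xi (e j + n.+1).*2; have := xi (e j + n.+1).*2.+1.
    by rewrite /a /b expnS natrM /=; lra.
  exists (exist _ _ inv') => i im /=.
  by rewrite /xs' (ltn_eqF im).
pose T := fix T m : {p | inv m p} :=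
  if m is k.+1 return {p | inv m p} then sval (step k (T k)) else base.
(* The point for digit i is chosen in building level i + 1 and never changes afterwards. *)
pose s m := (sval (T m)).1 0%N; pose xi i := (sval (T i.+1)).2 i.
have Txi i m : (i < m)%N -> (sval (T m)).2 i = xi i.
  elim: m => // m IHm; rewrite ltnS leq_eqVlt => /orP[/eqP ->//|im].
  by rewrite /= (svalP (step m (T m)))// IHm.
have sm m : size (s m) = (2 ^ m)%N by have [[h _] _] := svalP (T m); exact: h.
have radi i m : (i < m)%N -> N (xi i) <= 1 /\ c1 * 2 ^+ m <= rad phi m i (s m) (xi i).
  move=> im; have [_ /(_ i im)] := svalP (T m); rewrite Txi// natrX => -[x1 h].
  by split => //; exact: h.
pose g i m x := 2^-1 ^+ m * rad phi m i (s m) x.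
have p20 m : 0 < 2^-1 ^+ m :> R by rewrite exprn_gt0// invr_gt0.
have p22 m : 2^-1 ^+ m * 2 ^+ m = 1 :> R by rewrite -exprMn mulVf// expr1n.
have bes m x : \sum_(i < m) g i m x ^+ 2 <= N x ^+ 2.
  have := bessel_rad (sm m) (fun n => dual_le x (phil n) (phiN n)).
  move=> h; have {h} : \sum_(i < m) rad phi m i (s m) x ^+ 2 <= (2 ^+ m * N x) ^+ 2.
    by apply: le_trans h; rewrite lerDr sqr_ge0.
  rewrite -(ler_pM2l (exprn_gt0 2 (p20 m))) -exprMn mulrA p22 mul1r mulr_sumr.
  by under eq_bigr do rewrite -exprMn.
have gle i m x : (i < m)%N -> `|g i m x| <= N x.
  move=> im; rewrite -(@ler_pXn2r _ 2)// ?nnegrE ?N_ge0// real_normK ?num_real//.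
  apply: le_trans (bes m x); rewrite (bigD1 (Ordinal im))//= lerDl.
  by apply: sumr_ge0 => k _; exact: sqr_ge0.
have gle' i m x : `|g i m x| <= N x.
  have [/gle//|mi] := ltnP i m.
  by rewrite /g rad_ge// mulr0 normr0 N_ge0.
have gbd i x : bounded_sequence (fun m => g i m x) by exists (N x) => m; exact: gle'.
have dg i m : dual (g i m) by apply: dualZ; exact: dual_rad.
have [L [Llin Lsqr Lle Lge]] := ultralimit_exists R.
have bd0 : bounded_sequence (fun=> 0 : R) by exists 0 => _; rewrite normr0.
have L0 : L (fun=> 0) = 0.
  have := Llin 1 _ _ bd0 bd0; under [X in L X]eq_fun do rewrite mulr0 addr0.
  lra.
have bdD (u v : nat -> R) : bounded_sequence u -> bounded_sequence v -> bounded_sequence (fun n => u n + v n).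
  move=> [C uC] [D vD]; exists (C + D) => n.
  by apply: le_trans (ler_normD _ _) _; exact: lerD.
have bdsq (u : nat -> R) : bounded_sequence u -> bounded_sequence (fun n => u n ^+ 2).
  by move=> [C uC]; exists (C ^+ 2) => n; rewrite normrX lerXn2r ?nnegrE// (le_trans _ (uC n)).
(* For fixed i the averages of all levels m > i are at least c1 at [xi i], and so is their limit. *)
pose f i x := L (fun m => g i m x).
have df i : dual (f i).
  apply: (dualP (C := 1)) => [a x y|x].
    by rewrite /f -Llin//; congr L; apply/funext => m; rewrite (dg i m).1.
  rewrite mul1r; apply: (Lle _ _ 0%N) => // m _.
  exact: le_trans (ler_norm _) (gle' i m x).
have Lsum k x : L (fun m => \sum_(i < k) g i m x ^+ 2) = \sum_(i < k) f i x ^+ 2 /\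
    bounded_sequence (fun m => \sum_(i < k) g i m x ^+ 2).
  elim: k => [|k [IHk bk]].
    have -> : (fun m => \sum_(i < 0) g i m x ^+ 2) = fun=> 0.
      by apply/funext => m; rewrite big_ord0.
    by rewrite big_ord0.
  have -> : (fun m => \sum_(i < k.+1) g i m x ^+ 2) =
      fun m => 1 * (\sum_(i < k) g i m x ^+ 2) + g k m x ^+ 2.
    by apply/funext => m; rewrite big_ord_recr mul1r.
  split; first by rewrite Llin ?IHk ?mul1r ?Lsqr ?big_ord_recr//; exact: bdsq.
  have -> : (fun m => 1 * (\sum_(i < k) g i m x ^+ 2) + g k m x ^+ 2) =
      fun m => \sum_(i < k) g i m x ^+ 2 + g k m x ^+ 2.
    by apply/funext => m; rewrite mul1r.
  by apply: bdD => //; exact: bdsq.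
apply: (@spread_bessel c c1 f) => // [i|k x].
  exists (xi i); first by case: (radi i i.+1 (ltnSn i)).
  apply: (Lge _ _ i.+1) => // m im; have [_ h] := radi i m im.
  by rewrite /g -(ler_pM2l (p20 m)) mulrCA p22 mulr1 in h *.
have [<- bk] := Lsum k x; apply: (Lle _ _ k) => // m km.
apply: le_trans (bes m x); rewrite (big_ord_widen m (fun i => g i m x ^+ 2))//.
rewrite [leRHS](bigID (fun i : 'I_m => (i < k)%N)) /= lerDl.
by apply: sumr_ge0 => j _; exact: sqr_ge0.
Qed.

(** * Rademacher sums over finite segments *)

Lemma tree_level_iota (M : set nat) m (e : nat -> nat) :
  strictly_increasing e -> (forall n, M (e n)) ->
  tree_level M m (fun j => map e (iota (j * 2 ^ m) (2 ^ m))).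
Proof.
move=> einc eM; split => [j|i j ij]; first by rewrite size_map size_iota.
have inM k : increasing_in M (map e (iota k (2 ^ m))).
  split; first by apply: sorted_map_incr => //; exact: iota_ltn_sorted.
  by move=> _ /mapP[n _ ->].
apply/increasing_in_cat; split => // _ _ /mapP[a + ->] /mapP[b + ->].
rewrite !mem_iota => /andP[_ ai] /andP[jb _]; apply: einc.
by apply: leq_trans ai _; apply: leq_trans jb; rewrite addnC -mulSn leq_mul2r ij orbT.
Qed.

Lemma increasing_in_flatten (M : set nat) m (t : nat -> seq nat) D :
  tree_level M m t -> sorted ltn D -> increasing_in M (flatten (map t D)).
Proof.
move=> [tm tM]; elim: D => [|j D IHD] /=; first by split.
rewrite (path_sortedE ltn_trans) => /andP[/allP jD Ds].
apply/increasing_in_cat; split.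
- by have /increasing_in_cat[] := tM j j.+1 (ltnSn j).
- exact: IHD.
- move=> a b aj /flatten_mapP[k kD bk].
  by have /increasing_in_cat[_ _] := tM j k (jD k kD); apply.
Qed.

(** The sign for digit i depends only on the position inside a chunk of length 2 ^ (i + 1), so these
    sums are additive over chunks. *)
Lemma rad_flatten phi i k (t : nat -> seq nat) D x : size D = (2 ^ k)%N ->
  (forall j, size (t j) = 2 ^ i.+1)%N ->
  rad phi (k + i.+1) i (flatten (map t D)) x = \sum_(j <- D) rad phi i.+1 i (t j) x.
Proof.
move=> + ti; elim: k D => [|k IHk] D Dk.
  by case: D Dk => // j [|//] _; rewrite /= cats0 big_seq1.
have szf E : size E = (2 ^ k)%N -> size (flatten (map t E)) = (2 ^ (k + i.+1))%N.
  move=> Ek; rewrite size_flatten /shape -map_comp expnD -Ek.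
  by elim: E {Ek} => //= j E ->; rewrite ti mulSn.
have [D1 [D2 [D1k D2k ->]]] : exists D1 D2,
    [/\ size D1 = (2 ^ k)%N, size D2 = (2 ^ k)%N & D = D1 ++ D2].
  exists (take (2 ^ k) D), (drop (2 ^ k) D); rewrite cat_take_drop size_drop size_take Dk.
  by rewrite expnS; split=> //; [rewrite ltn_Pmull ?expn_gt0|rewrite mul2n -addnn addnK].
rewrite map_cat flatten_cat big_cat addSn rad_cat ?szf// ltn_eqF; last by lia.
by rewrite !IHk.
Qed.

(** In Ramsey's dichotomy the negative case is refuted by 2 ^ (L - i - 1) chunks, found by [spread],
    whose sums for digit i are all at least c / 4 * 2 ^ i * c at one point; their total is c * c / 8
    * 2 ^ L. *)
Lemma rad_large (c : R) phi L i (A : set nat) : 0 < c -> spread c ->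
  (forall n, dual (phi n)) ->
  (forall i j, (i < j)%N -> big (fun x => phi i x - phi j x) 1) ->
  (i < L)%N -> unbounded A ->
  exists M, [/\ M `<=` A, unbounded M & forall s, size s = (2 ^ L)%N ->
    increasing_in M s -> big (rad phi L i s) (c * c / 8 * 2 ^+ L)].
Proof.
move=> c0 sc dphi sphi iL Au.
have [|M1 [M1A M1u M1b]] := block_large (m := (2 ^ i)%N) c0 sc dphi sphi _ Au.
  by rewrite expn_gt0.
have [M [MM1 Mu [hM|hM]]] := ramsey (fun s => big (rad phi L i s) (c * c / 8 * 2 ^+ L)) (2 ^ L) M1u.
  by exists M; split => //; exact: subset_trans M1A.
exfalso.
have [e [einc eM]] := unbounded_eta Mu.
pose t j := map e (iota (j * 2 ^ i.+1) (2 ^ i.+1)).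
have tl : tree_level M i.+1 t by apply: tree_level_iota => // n; rewrite -eM; exists n.
have [|||x [D [x1 Dh Ds Dk]]] := @spread_scale c (c / 4 * (2 ^ i)%:R)
    (2 ^ (L - i.+1)) (fun j => rad phi i.+1 i (t j)) sc.
- by rewrite mulr_gt0 ?divr_gt0// ltr0n expn_gt0.
- by move=> j; exact: dual_rad.
- move=> j; have [tm tM] := tl; have /increasing_in_cat[tj _ _] := tM j j.+1 (ltnSn j).
  have : (take (2 ^ i) (t j) ++ drop (2 ^ i) (t j)) = t j by rewrite cat_take_drop.
  move=> tE; rewrite -tE in tj.
  have -> : rad phi i.+1 i (t j) =
      fun x => block phi (take (2 ^ i) (t j)) x - block phi (drop (2 ^ i) (t j)) x.
    by apply/funext => x /=; rewrite eqxx.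
  apply: M1b; last exact: increasing_inS tj.
    by rewrite size_take tm ltn_exp2l// ltnSn.
  by rewrite size_drop tm expnS mul2n -addnn addnK.
apply: (hM (flatten (map t D))).
- rewrite size_flatten /shape -map_comp.
  have -> : (2 ^ L = size D * 2 ^ i.+1)%N by rewrite Dh -expnD subnK.
  by elim: D {Dh Ds Dk} => //= j D ->; case: tl => tm _; rewrite tm mulSn.
- exact: increasing_in_flatten tl Ds.
- exists x => //; have LE : L = (L - i.+1 + i.+1)%N by rewrite subnK.
  rewrite [X in rad _ X]LE rad_flatten//; last by case: tl.
  have := sum_ge_const Dk; rewrite Dh [X in 2 ^+ X]LE exprD exprS natrX natrX; lra.
Qed.

(* The negation implies [spread], under which the Rademacher averages of a
   homogeneous sequence are bounded below and satisfy a Bessel inequality. *)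
Theorem uniformly_few_large (c : R) : 0 < c -> exists k : nat, forall L : nat, exists psi,
  [/\ forall l, dual (psi l), forall l, (l < L)%N -> big (psi l) 1 &
      forall x, N x <= 1 -> (count (fun l => (c <= `|psi l x|)%R) (iota 0 L) <= k)%N].
Proof.
move=> c0; apply: contrapT => hc.
have sc : spread c.
  (* With more than 2 h values of modulus at least c, one of [x] and [- x] has h values at least
     c. *)
  move=> h psi dpsi bpsi; have /existsNP[L hL] := (forallNP _).2 hc (h + h)%N.
  have [x [x1 xh]] : exists x, N x <= 1 /\
      (h + h < count (fun l => (c <= `|psi l x|)%R) (iota 0 L))%N.
    apply: contrapT => hx; apply: hL; exists psi; split => // x x1.
    by rewrite leqNgt; apply/negP => xh; apply: hx; exists x.
  have fin y : N y <= 1 -> (h <= count (fun l => (c <= psi l y)%R) (iota 0 L))%N ->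
      exists x s, [/\ N x <= 1, size s = h, sorted ltn s & {in s, forall k, c <= psi k x}].
    move=> y1 hy; exists y, (take h [seq l <- iota 0 L | c <= psi l y]); split => //.
    - by rewrite size_takel// size_filter.
    - apply: take_sorted; apply: sorted_filter; first exact: ltn_trans.
      exact: iota_ltn_sorted.
    - by move=> k /mem_take; rewrite mem_filter => /andP[].
  have [/fin|hx] := leqP h (count (fun l => (c <= psi l x)%R) (iota 0 L)); first exact.
  apply: (fin (- x)); first by rewrite N_opp.
  rewrite leqNgt; apply/negP => hx'.
  have := count_predUI (fun l => (c <= psi l x)%R) (fun l => (c <= psi l (- x))%R) (iota 0 L).
  suff : (count (fun l => (c <= `|psi l x|)%R) (iota 0 L) <=
      count (predU (fun l => (c <= psi l x)%R) (fun l => (c <= psi l (- x))%R)) (iota 0 L))%N by lia.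
  apply: sub_count => l /=; rewrite (real_linearN _ (dpsi l).1).
  by rewrite real_ler_normr ?num_real.
have [phi [phil phiN phis]] := separated_sequence infX.
have dphi n : dual (phi n) by apply: (dualP (C := 1)) => // x; rewrite mul1r.
pose c2 := c * c / 8.
have c20 : 0 < c2 by rewrite /c2 divr_gt0 ?mulr_gt0.
(* The Bessel inequality bounds the number of normalized averages of size c by (c2 * c) ^- 2,
   whatever L is. *)
apply: hc; exists (Num.trunc ((c2 * c) ^+ 2)^-1) => L.
have [M [Mu Mb]] : exists M, unbounded M /\ forall i, (i < L)%N ->
    forall s, size s = (2 ^ L)%N -> increasing_in M s -> big (rad phi L i s) (c2 * 2 ^+ L).
  suff : forall n, (n <= L)%N -> exists M, unbounded M /\ forall i, (i < n)%N ->
      forall s, size s = (2 ^ L)%N -> increasing_in M s -> big (rad phi L i s) (c2 * 2 ^+ L).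
    by apply.
  elim=> [_|n IHn nL]; first by exists setT; split => // n; exists n.+1.
  have [M1 [M1u M1b]] := IHn (ltnW nL).
  have [M [MM1 Mu Mb]] := rad_large c0 sc dphi phis nL M1u.
  exists M; split => // i; rewrite ltnS leq_eqVlt => /orP[/eqP -> //|iN] s sL sM.
  by apply: M1b => //; exact: increasing_inS sM.
have [e [einc eM]] := unbounded_eta Mu.
pose s := map e (iota 0 (2 ^ L)).
have sL : size s = (2 ^ L)%N by rewrite size_map size_iota.
have sM : increasing_in M s.
  split; first by apply: sorted_map_incr => //; exact: iota_ltn_sorted.
  by move=> _ /mapP[n _ ->]; rewrite -eM; exists n.
have p0 : 0 < c2 * 2 ^+ L by rewrite mulr_gt0// exprn_gt0.
exists (fun l x => (c2 * 2 ^+ L)^-1 * rad phi L l s x); split.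
- by move=> l; apply: dualZ; exact: dual_rad.
- move=> l lL; have := big_scale (_ : 0 < (c2 * 2 ^+ L)^-1) (Mb l lL s sL sM).
  by rewrite invr_gt0 mulVf ?gt_eqF//; exact.
move=> x x1; have := bessel_rad sL (fun n => dual_le x (phil n) (phiN n)).
move=> bes; have {bes} : \sum_(l < L) rad phi L l s x ^+ 2 <= (2 ^+ L) ^+ 2.
  apply: (@le_trans _ _ ((2 ^+ L * N x) ^+ 2)).
    by apply: le_trans bes; rewrite lerDr sqr_ge0.
  by rewrite exprMn ler_piMr ?sqr_ge0// expr_le1// N_ge0.
move=> bes.
rewrite truncn_ge_nat ?invr_ge0 ?sqr_ge0//.
rewrite -size_filter -[leRHS]mul1r ler_pdivlMr ?exprn_gt0 ?mulr_gt0// mulrC.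
set D := [seq l <- _ | _].
have pc : 0 <= c2 * 2 ^+ L * c by rewrite ltW// mulr_gt0.
have : (c2 * 2 ^+ L * c) ^+ 2 * (size D)%:R <= (2 ^+ L) ^+ 2.
  apply: le_trans bes; apply: (@le_trans _ _ (\sum_(l <- D) rad phi L l s x ^+ 2)).
    apply: sum_ge_const => l; rewrite mem_filter => /andP[].
    rewrite normrM gtr0_norm ?invr_gt0// ler_pdivlMl// => h _.
    by rewrite -[leRHS]real_normK ?num_real// lerXn2r ?nnegrE.
  apply: (sum_seq_le_ord (f := fun l => rad phi L l s x ^+ 2)).
  - by apply: sorted_filter; [exact: ltn_trans|exact: iota_ltn_sorted].
  - by move=> l; exact: sqr_ge0.
  - by move=> l; rewrite mem_filter mem_iota => /andP[_].
have -> : (c2 * 2 ^+ L * c) ^+ 2 = (2 ^+ L) ^+ 2 * (c2 * c) ^+ 2 by ring.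
by rewrite -mulrA -[leRHS]mulr1 ler_pM2l// !exprn_gt0.
Qed.

End normed.

(** * Real and complex scalars *)

(* A uniform treatment of the two scalar fields: emb embeds the reals, rp is
   the real part, and (phase, cophase) is (1, 0) over the reals and ('i, - 'i)
   over the complex numbers. *)
Record real_form (R : realType) (K : numFieldType) := RealForm {
  emb : {rmorphism R -> K};
  rp : K -> R;
  phase : K;
  cophase : K;
  rpD : forall x y, rp (x + y) = rp x + rp y;
  rpZ : forall a x, rp (emb a * x) = a * rp x;
  rp1 : rp 1 = 1;
  emb_ge0 : forall a, (0 <= emb a) = (0 <= a);
  emb_pos : forall t, 0 <= t -> emb (rp t) = t;
  rp_norm : forall z, `|rp z| <= rp `|z|;
  norm_phase : `|phase| = 1;
  norm_cophase : `|cophase| <= 1;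
  rp_cophase : rp cophase = 0;
  rp_decomp : forall z, z = emb (rp z) + cophase * emb (rp (phase * z));
  real_lift : forall (X : lmodType K) (u : X -> R),
    (forall a x y, u (emb a *: x + y) = a * u x + u y) ->
    exists T : {linear X -> K^o}, forall x,
      T x = emb (u x) + cophase * emb (u (phase *: x))
}.

Section real_form_exists.
Variable R : realType.

Lemma real_form_real : real_form R R.
Proof.
apply: (@RealForm R R idfun idfun 1 0) => //=.
- by rewrite normr1.
- by rewrite normr0.
- by move=> z; rewrite mul0r addr0.
- move=> X u ul.
  pose T := GRing.isLinear.Build R X R^o *:%R u ul.
  by exists (HB.pack u T : {linear X -> R^o}) => x /=; rewrite mul0r addr0.
Qed.

Lemma real_form_complex : real_form R (R[i] : numFieldType).
Proof.
apply: (@RealForm R (R[i] : numFieldType) (real_complex R) (@complex.Re R) 'i%C (- 'i%C)).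
- by case=> a b [c d].
- by move=> a [b c] /=; rewrite mul0r subr0.
- by [].
- by move=> a; rewrite ler0c.
- by case=> a b; rewrite lecE /= => /andP[/eqP -> _].
- by move=> z; have := normc_ge_Re z; rewrite lecE => /andP[_].
- by rewrite normc_def /= expr0n expr1n add0r sqrtr1.
- by rewrite normrN normc_def /= expr0n expr1n add0r sqrtr1.
- by rewrite /= oppr0.
- by case=> a b; apply/eqP; rewrite eq_complex /=; apply/andP; split; apply/eqP; ring.
- move=> X u ul.
  have uD x y : u (x + y) = u x + u y.
    by have := ul 1 x y; rewrite rmorph1 scale1r mul1r.
  have u0 : u 0 = 0 by have := uD 0 0; rewrite addr0; lra.
  have uZ a x : u (a%:C%C *: x) = a * u x by have := ul a x 0; rewrite !addr0 u0 addr0.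
  have iE (a : R[i]) (x : X) : a *: x = (complex.Re a)%:C%C *: x + (complex.Im a)%:C%C *: ('i%C *: x).
    by rewrite scalerA -scalerDl mulrC -complexE.
  pose f x : R[i] := (u x)%:C%C + - 'i%C * (u ('i%C *: x))%:C%C.
  have fl : linear (f : X -> (R[i] : numFieldType)^o).
    have uN x : u (- x) = - u x by apply/eqP; rewrite -addr_eq0 addrC -uD subrr u0.
    have ii x : 'i%C *: ('i%C *: x) = - x :> X.
      by rewrite scalerA -expr2 sqr_i scaleN1r.
    move=> a x y; rewrite /f uD scalerDr uD (iE a x) uD !uZ scalerDr uD.
    rewrite !scalerA ![ 'i%C * _]mulrC -!scalerA !uZ ii uN.
    case: a => a b; apply/eqP; rewrite eq_complex /=.
    by apply/andP; split; apply/eqP; ring.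
  pose T := GRing.isLinear.Build R[i] X (R[i] : numFieldType)^o *:%R f fl.
  by exists (HB.pack f T : {linear X -> (R[i] : numFieldType)^o}).
Qed.

End real_form_exists.

Lemma real_or_complex_form (R : realType) (K : numFieldType) :
  real_or_complex R K -> inhabited (real_form R K).
Proof.
by case=> ->; split; [exact: real_form_real|exact: real_form_complex].
Qed.

Section real_form_theory.
Variables (R : realType) (K : numFieldType) (D : real_form R K).
Implicit Types (x y z : K) (a b : R).
Local Notation emb := (emb D).
Local Notation rp := (rp D).

Lemma rpK a : rp (emb a) = a.
Proof. by rewrite -[emb a]mulr1 rpZ rp1 mulr1. Qed.

Lemma rp0 : rp 0 = 0.
Proof. by have := rpD D 0 0; rewrite addr0; lra. Qed.

Lemma rpN x : rp (- x) = - rp x.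
Proof. by apply/eqP; rewrite -addr_eq0 addrC -rpD subrr rp0. Qed.

Lemma emb_le a b : (emb a <= emb b) = (a <= b).
Proof. by rewrite -subr_ge0 -rmorphB emb_ge0 subr_ge0. Qed.

Lemma emb_inj : injective emb.
Proof. by move=> a b /(congr1 rp); rewrite !rpK. Qed.

Lemma emb_lt a b : (emb a < emb b) = (a < b).
Proof. by rewrite !lt_def emb_le (inj_eq emb_inj). Qed.

Lemma emb_gt0 a : (0 < emb a) = (0 < a).
Proof. by rewrite -(rmorph0 emb) emb_lt. Qed.

Lemma rp_ge0 x : 0 <= x -> 0 <= rp x.
Proof. by move=> x0; rewrite -(emb_ge0 D) emb_pos. Qed.

Lemma rp_gt0 x : 0 < x -> 0 < rp x.
Proof. by move=> x0; rewrite -emb_gt0 emb_pos// ltW. Qed.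

Lemma rp_le x y : 0 <= x -> 0 <= y -> (rp x <= rp y) = (x <= y).
Proof. by move=> x0 y0; rewrite -emb_le !emb_pos. Qed.

Lemma rpM x y : 0 <= x -> rp (x * y) = rp x * rp y.
Proof. by move=> x0; rewrite -[X in rp (X * _)](emb_pos D)// rpZ. Qed.

Lemma norm_emb a : `|emb a| = emb `|a|.
Proof.
have [a0|a0] := leP 0 a; first by rewrite !ger0_norm// emb_ge0.
by rewrite !ltr0_norm// ?rmorphN// -(rmorph0 emb) emb_lt.
Qed.

Lemma archimedean_scalar (t : K) : 0 <= t -> exists n : nat, t < n%:R.
Proof.
move=> t0; exists (Num.trunc (rp t)).+1.
by rewrite -[ltLHS](emb_pos D t0) -(rmorph_nat emb) emb_lt truncnS_gt.
Qed.

End real_form_theory.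

(** A copy of [X], so that the restricted scalars do not compete with its [K]-module structure. *)
Definition realified (R : realType) (K : numFieldType) (D : real_form R K)
  (X : lmodType K) : Type := X.

Section realified_lmodule.
Variables (R : realType) (K : numFieldType) (D : real_form R K) (X : lmodType K).

HB.instance Definition _ := GRing.Zmodule.on (realified D X).

Definition realified_scale (a : R) (x : realified D X) : realified D X :=
  emb D a *: (x : X).

Let realified_scaleA a b x :
  realified_scale a (realified_scale b x) = realified_scale (a * b) x.
Proof. by rewrite /realified_scale scalerA rmorphM. Qed.

Let realified_scale1 : left_id 1 realified_scale.
Proof. by move=> x; rewrite /realified_scale rmorph1 scale1r. Qed.

Let realified_scaleDr : right_distributive realified_scale +%R.
Proof. by move=> a x y; rewrite /realified_scale scalerDr. Qed.

Let realified_scaleDl x : {morph realified_scale^~ x : a b / a + b}.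
Proof. by move=> a b; rewrite /realified_scale rmorphD scalerDl. Qed.

HB.instance Definition _ := GRing.Zmodule_isLmodule.Build R (realified D X)
  realified_scaleA realified_scale1 realified_scaleDr realified_scaleDl.

Lemma realified_infinite_dimensional : infinite_dimensional X ->
  ~ (exists (n : nat) (e : 'I_n -> realified D X),
      forall x, exists c : 'I_n -> R, x = \sum_(i < n) c i *: e i).
Proof.
move=> infX [n [e xe]]; apply: infX; exists n, e => x.
by have [c ->] := xe x; exists (fun i => emb D (c i)).
Qed.

End realified_lmodule.

Section normed_scalar.
Variables (R : realType) (K : numFieldType) (D : real_form R K) (X : normedModType K).
Local Notation emb := (emb D).
Local Notation rp := (rp D).

(** Norms take values in [K]; [rp] loses nothing on nonnegative elements. *)
Definition rnorm (V : normedModType K) (x : V) : R := rp `|x|.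

Lemma rnormD (V : normedModType K) (x y : V) : rnorm (x + y) <= rnorm x + rnorm y.
Proof. by rewrite /rnorm -rpD rp_le ?addr_ge0// ler_normD. Qed.

Lemma rnormZ (V : normedModType K) (k : K) (x : V) : rnorm (k *: x) = rp `|k| * rnorm x.
Proof. by rewrite /rnorm normrZ rpM. Qed.

Lemma rnormZ_emb (V : normedModType K) a (x : V) : rnorm (emb a *: x) = `|a| * rnorm x.
Proof. by rewrite rnormZ norm_emb rpK. Qed.

Lemma rnorm_ge0 (V : normedModType K) (x : V) : 0 <= rnorm x.
Proof. by rewrite rp_ge0. Qed.

Lemma rnorm_eq0 (V : normedModType K) (x : V) : rnorm x = 0 -> x = 0.
Proof.
by move=> x0; apply/eqP; rewrite -normr_eq0 -(emb_pos D (normr_ge0 x)) -/(rnorm x) x0 rmorph0.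
Qed.

Lemma rnormE (V : normedModType K) (x : V) : `|x| = emb (rnorm x).
Proof. by rewrite emb_pos. Qed.

Lemma rnorm_lt (V : normedModType K) (x : V) a : (`|x| < emb a) = (rnorm x < a).
Proof. by rewrite rnormE emb_lt. Qed.

Let rN (x : realified D X) : R := rnorm (x : X).

Let rND (x y : realified D X) : rN (x + y) <= rN x + rN y.
Proof. exact: rnormD. Qed.

Let rNZ a (x : realified D X) : rN (a *: x) = `|a| * rN x.
Proof. exact: rnormZ_emb. Qed.

Let rN0 (x : realified D X) : rN x = 0 -> x = 0.
Proof. exact: rnorm_eq0. Qed.

(** [T] has real part [u]. The upper bound reduces smallness of [T] at [x] to smallness of [u] at
    [x] and at [phase D *: x], which have equal norms. *)
Lemma dual_lift (u : realified D X -> R) : dual rN u -> exists T : {linear X -> K^o},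
  [/\ continuous T, forall x, `|u x| <= rnorm (T x : K^o) &
      forall x, rnorm (T x : K^o) <= `|u x| + `|u (phase D *: x)|].
Proof.
move=> du; have [C C0 uC] := dual_norm rND rNZ du.
have [T TE] := @real_lift R K D X u du.1; exists T.
have Tle x : rnorm (T x : K^o) <= `|u x| + `|u (phase D *: x)|.
  rewrite TE; apply: le_trans (rnormD _ _) _; apply: lerD.
    by rewrite /rnorm norm_emb rpK.
  rewrite /rnorm normrM norm_emb rpM// rpK ler_piMl//.
  by rewrite -(rp1 D) rp_le// norm_cophase.
split => //; last first.
  move=> x; apply: le_trans (rp_norm D _).
  by rewrite TE rpD mulrC rpZ rp_cophase mulr0 addr0 rpK.
apply: bounded_linear_continuous; rewrite /bounded_near.
near=> M; apply/nbhs_ballP; exists 1 => //= x; rewrite -ball_normE /= sub0r normrN => x1.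
suff : `|T x : K^o| <= emb (C + C).
  by move=> h; apply: le_trans h _; near: M; apply: nbhs_pinfty_ge; rewrite realE emb_ge0 addr_ge0.
rewrite rnormE emb_le; apply: le_trans (Tle x) _.
have x1' : rnorm x <= 1 by rewrite -(rp1 D) rp_le// ltW.
apply: lerD; apply: le_trans (uC _) _; rewrite -[leRHS]mulr1 ler_wpM2l//.
by rewrite /rN rnormZ norm_phase rp1 mul1r.
Unshelve. all: by end_near. Qed.

Hypothesis infX : infinite_dimensional X.

Lemma half_double (m : R) : m^-1 = (m + m)^-1 + (m + m)^-1.
Proof.
have -> : m + m = m * 2 by ring.
by rewrite invfM -splitr.
Qed.

Lemma scalar_almost_null (m : R) : 0 < m -> exists T : nat -> {linear X -> K^o},
  [/\ forall k, continuous (T k),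
      forall k, exists2 x, rnorm x <= 1 & m <= rnorm (T k x : K^o) &
      forall x, rnorm x <= 1 ->
        exists k0, forall k, (k0 <= k)%N -> rnorm (T k x : K^o) < 1].
Proof.
(* After scaling by m, the values at [x] and at [phase D *: x] contribute less than 1 / 2 each. *)
move=> m0; have c0 : 0 < (m + m)^-1 by rewrite invr_gt0 addr_gt0.
have [psi [dpsi bpsi psi0]] :=
  almost_null_sequence rND rNZ rN0 (realified_infinite_dimensional (D := D) infX) c0.
have [T TP] := choice (fun k => dual_lift (dualZ rND rNZ m (dpsi k))).
exists T; split => [k|k|x x1]; first by case: (TP k).
- have [x x1 h] := bpsi k; exists x => //; have [_ + _] := TP k.
  move=> /(_ x); apply: le_trans; apply: le_trans (ler_norm _).
  by rewrite ler_peMr// ltW.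
have [k1 h1] := psi0 x x1.
have [|k2 h2] := psi0 (phase D *: (x : X)).
  by rewrite /rN rnormZ norm_phase rp1 mul1r.
exists (maxn k1 k2) => k; rewrite geq_max => /andP[/h1 {}h1 /h2 {}h2].
have [_ _ h] := TP k; apply: le_lt_trans (h x) _.
rewrite !normrM (gtr0_norm m0) -mulrDr -ltr_pdivlMl// mulr1.
by rewrite half_double; exact: ltrD.
Qed.

Lemma scalar_few_large (m : R) : 0 < m -> exists k : nat, forall L : nat,
  exists T : nat -> {linear X -> K^o},
  [/\ forall l, continuous (T l),
      forall l, (l < L)%N -> exists2 x, rnorm x <= 1 & m <= rnorm (T l x : K^o) &
      forall x, rnorm x <= 1 ->
        (count (fun l => (1 <= rnorm (T l x : K^o))%R) (iota 0 L) <= k)%N].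
Proof.
move=> m0; have c0 : 0 < (m + m)^-1 by rewrite invr_gt0 addr_gt0.
have [k kP] :=
  uniformly_few_large rND rNZ rN0 (realified_infinite_dimensional (D := D) infX) c0.
(* A large value of [T l] at [x] comes from a large value of [psi l] at [x] or at [phase D *: x]. *)
exists (k + k)%N => L; have [psi [dpsi bpsi psik]] := kP L.
have [T TP] := choice (fun k => dual_lift (dualZ rND rNZ m (dpsi k))).
exists T; split => [l|l lL|x x1]; first by case: (TP l).
- have [x x1 h] := bpsi l lL; exists x => //; have [_ + _] := TP l.
  move=> /(_ x); apply: le_trans; apply: le_trans (ler_norm _).
  by rewrite ler_peMr// ltW.
have px1 : rN (phase D *: (x : X)) <= 1 by rewrite /rN rnormZ norm_phase rp1 mul1r.
pose c := (m + m)^-1.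
have := count_predUI (fun l => (c <= `|psi l x|)%R)
  (fun l => (c <= `|psi l (phase D *: (x : X))|)%R) (iota 0 L).
have := psik x x1; have := psik _ px1; rewrite -/c.
suff : (count (fun l => (1 <= rnorm (T l x : K^o))%R) (iota 0 L) <=
    count (predU (fun l => (c <= `|psi l x|)%R)
      (fun l => (c <= `|psi l (phase D *: (x : X))|)%R)) (iota 0 L))%N by lia.
apply: sub_count => l /=; have [_ _ /(_ x) h] := TP l => h1.
have := le_trans h1 h; rewrite !normrM (gtr0_norm m0) -mulrDr.
rewrite -ler_pdivrMl// mulr1 half_double; apply: contraTT.
by rewrite negb_or -!ltNge => /andP[? ?]; exact: ltrD.
Qed.

End normed_scalar.

Lemma count_le_in (T : eqType) (a b : pred T) (s : seq T) :
  {in s, forall x, a x -> b x} -> (count a s <= count b s)%N.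
Proof.
elim: s => //= x s IHs ab; apply: leq_add.
  by case: (boolP (a x)) => // ax; rewrite ab ?inE ?eqxx.
by apply: IHs => y ys; apply: ab; rewrite inE ys orbT.
Qed.

(** * Necessity of the conditions on the filter *)

Section necessity.
Variables (R : realType) (K : numFieldType) (D : real_form R K) (X : normedModType K).
Variables (F : set_system nat) (FF : ProperFilter F) (F_free : free_filter F).
Hypothesis infX : infinite_dimensional X.
Hypothesis ubpX : uniform_boundedness_principle F X.
Local Notation rnorm := (rnorm D).

Lemma free_filter_ge n : F [set i | (n <= i)%N].
Proof.
apply: F_free; apply: (sub_finite_set _ (finite_II n)) => i /= /negP.
by rewrite -ltnNge.
Qed.

(** The case [Y = K^o] of the principle, with both boundedness and equicontinuity scaled to the unit
    ball. *)
Lemma uniform_boundedness_scalar (T : nat -> {linear X -> K^o}) :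
  (forall i, continuous (T i)) ->
  (forall x, rnorm x <= 1 -> F [set i | rnorm (T i x : K^o) < 1]) ->
  exists m : nat, F [set i | forall x, rnorm x <= 1 -> rnorm (T i x : K^o) < m%:R].
Proof.
move=> Tc Tb.
have Tpb : @pointwise_filter_bounded K X K^o F T.
  move=> x V /nbhs_ballP[e /= e0 eV].
  pose r := `|x| + 1; have r0 : 0 < r by rewrite ltr_wpDl.
  exists (e / r); first exact: divr_gt0.
  have : F [set i | rnorm (T i (r^-1 *: x) : K^o) < 1].
    apply: Tb; rewrite rnormZ -rpM// -(rp1 D) rp_le ?mulr_ge0//.
    by rewrite normfV gtr0_norm// ler_pdivrMl// mulr1 lerDl.
  apply: filterS => i /= Ti; apply: eV; rewrite -ball_normE /= sub0r normrN.
  have -> : e / r *: T i x = e *: (T i (r^-1 *: x) : K^o) :> K^o by rewrite linearZ /= scalerA.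
  rewrite normrZ gtr0_norm// -[ltRHS]mulr1 ltr_pM2l//.
  by rewrite (rnormE D) -(rmorph1 (emb D)) emb_lt.
have V0 : nbhs (0 : K^o) (ball (0 : K^o) 1) by exact: nbhsx_ballx.
have [U U0 TU] := @ubpX K^o T Tc Tpb _ V0.
move/nbhs_ballP : U0 => [e /= e0 eU].
have e20 : 0 < 2 / e by rewrite divr_gt0.
have [m em] := archimedean_scalar D (ltW e20).
have m0 : 0 < m%:R :> K by exact: lt_trans em.
exists m; apply: filterS TU => i TU x x1.
have : ball (0 : K^o) 1 (T i (m%:R^-1 *: x)).
  apply: TU; exists (m%:R^-1 *: x) => //; apply: eU.
  rewrite -ball_normE /= sub0r normrN normrZ normfV gtr0_norm// ltr_pdivrMl//.
  have x1' : `|x| <= 1 by rewrite (rnormE D) -(rmorph1 (emb D)) emb_le.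
  apply: le_lt_trans x1' _; have : 1 < 2 :> K by rewrite ltr1n.
  by move=> /lt_trans; apply; rewrite -ltr_pdivrMr.
rewrite -ball_normE /= sub0r normrN linearZ normrZ normfV (gtr0_norm m0) ltr_pdivrMl// mulr1.
by rewrite -(rnorm_lt D) rmorph_nat.
Qed.

(* For i in A j but not in A j.+1 the functional T i is taken from an almost
   null sequence of functionals of norm at least j + 1; at a given point only
   finitely many of them in each such layer are large. *)
Theorem ubp_P_plus : P_plus_filter F.
Proof.
move=> A AS Ast; apply: contrapT => nB.
have Ale j k : (j <= k)%N -> A k `<=` A j.
  by move=> /subnK <-; elim: (k - j)%N => // n IHn; exact: subset_trans (AS _) IHn.
(* Failure of P+ along [A]: sets almost contained in every [A k] are not stationary. *)
have small B : (forall k, almost_subset B (A k)) -> F (~` B).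
  by move=> BA; apply: contrapT => BF; apply: nB; exists B.
have [S SP] := choice (fun j : nat => scalar_almost_null D infX (ltr0Sn R j)).
(* Points in no layer, that is outside [A 0] or in every [A k], get the zero functional. *)
have Tex i : exists Ti : {linear X -> K^o}, [/\ continuous Ti,
    forall j, A j i -> ~ A j.+1 i -> Ti = S j i &
    (forall j, A j i -> A j.+1 i) -> forall x, Ti x = 0].
  have [[j [Aj Aj1]]|nj] := pselect (exists j, A j i /\ ~ A j.+1 i).
    exists (S j i); split.
    - by case: (SP j).
    - move=> k Ak Ak1; congr (S _ i); apply/eqP; rewrite eqn_leq; apply/andP; split.
        by rewrite leqNgt; apply/negP => /Ale /(_ i Aj).
      by rewrite leqNgt; apply/negP => /Ale /(_ i Ak).
    - by move=> /(_ _ Aj).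
  exists \0; split => [|j Aj Aj1|//]; last by exfalso; apply: nj; exists j.
  by move=> x; exact: cvg_cst.
have [T TP] := choice Tex.
have [||m Fm] := @uniform_boundedness_scalar T.
- by move=> i; case: (TP i).
- move=> x x1; pose B := [set i | 1 <= rnorm (T i x : K^o)].
  suff : F (~` B) by apply: filterS => i /= /negP; rewrite -ltNge.
  apply: small => k.
  have [n nP] : exists n, forall j, (j < k)%N -> forall i, (n <= i)%N -> rnorm (S j i x : K^o) < 1.
    elim: k => [|k [n nP]]; first by exists 0%N.
    have [_ _ /(_ x x1)[n' nP']] := SP k.
    exists (maxn n n') => j; rewrite ltnS leq_eqVlt => /orP[/eqP ->|jk] i.
      by rewrite geq_max => /andP[_ /nP'].
    by rewrite geq_max => /andP[+ _]; exact: nP.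
  apply: (sub_finite_set _ (finite_II n)) => i [/= Bi Aki].
  rewrite ltnNge; apply/negP => ni.
  have [_ TS T0] := TP i.
  have [[j [Aj Aj1]]|nj] := pselect (exists j, A j i /\ ~ A j.+1 i).
    have jk : (j < k)%N by rewrite ltnNge; apply/negP => /Ale /(_ i Aj).
    by have := nP j jk i ni; rewrite -(TS j)// ltNge Bi.
  have Ti0 : T i x = 0.
    apply: T0 => j Aj; apply: contrapT => Aj1; apply: nj; by exists j.
  by move: Bi; rewrite /B /= Ti0 /rnorm normr0 rp0 ler10.
(* The intersection of all [A k] is negligible by [small], so the zero functionals there do no harm.
   Any other point of [A m] lies in a layer j >= m, where the norm exceeds the bound [m]. *)
apply: (Ast m); have FI : F (~` \bigcap_k A k).
  apply: small => k; apply: (sub_finite_set _ (finite_set0 _)) => i [/= iA] /=.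
  by apply; exact: iA.
apply: filterS (filterI Fm FI) => i [/= Tim iA Ami]; apply: iA => k _.
apply: contrapT => Aki; have [j [mj Aj Aj1]] : exists j, [/\ (m <= j)%N, A j i & ~ A j.+1 i].
  have : exists k, `[< ~ A k i >] by exists k; exact/asboolP.
  case/ex_minnP => [[|j]] /asboolP nA jmin.
    by exfalso; apply: nA; exact: (Ale 0%N m).
  exists j; split => //.
    by rewrite leqNgt; apply/negP => jm; apply: nA; exact: Ale Ami.
  by apply: contrapT => Aj; have /jmin : `[< ~ A j i >]; [exact/asboolP|rewrite ltnn].
have [_ /(_ j Aj Aj1) TS _] := TP i; have [_ /(_ i)[x x1 Sx] _] := SP j.
have := Tim x x1; rewrite TS ltNge => /negP; apply; apply: le_trans Sx.
by rewrite ler_nat leqW.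
Qed.

(* The scalar functionals on the n-th block [f (q n), f (q n.+1)) have norm at
   least n + 1, but at a given point boundedly many of them are large, with a
   bound that is known before the length of the block; hence the indices of the
   large ones grow faster than f. *)
Theorem ubp_rapid_plus : rapid_plus_filter F.
Proof.
move=> I f Ist finc; apply: contrapT => nB.
have [kk kkP] := choice (fun n : nat => scalar_few_large D infX (ltr0Sn R n)).
(* Bounds the number of large indices in the blocks 0 to n; the successors make it strictly
   increasing. *)
pose q n := (\sum_(j < n.+1) (kk j).+1)%N.
have qinc : strictly_increasing q.
  by apply: strictly_increasingP => n; rewrite /q [ltnRHS]big_ord_recr /= addnS ltnS leq_addr.
pose g n := f (q n).
have ginc : strictly_increasing g by move=> m n /qinc/finc.
pose L n := (g n.+1 - g n)%N.
have [S SP] := choice (fun n => kkP n (L n)).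
have block_uniq i n n' : (g n <= i < g n.+1)%N -> (g n' <= i < g n'.+1)%N -> n = n'.
  move=> /andP[a1 a2] /andP[b1 b2]; apply/eqP; rewrite eqn_leq; apply/andP; split.
    by rewrite leqNgt; apply/negP => /(strictly_increasing_le ginc); lia.
  by rewrite leqNgt; apply/negP => /(strictly_increasing_le ginc); lia.
have block_ex m i : (g m <= i)%N -> exists2 n, (m <= n)%N & (g n <= i < g n.+1)%N.
  move=> gi; have ex : exists n, (i < g n)%N.
    by exists i.+1; exact: strictly_increasing_ge.
  case: (ex_minnP ex) => -[|n] ign nmin.
    by have := strictly_increasing_le ginc (leq0n m); lia.
  exists n; last by rewrite ign andbT leqNgt; apply/negP => /nmin; rewrite ltnn.
  by rewrite leqNgt; apply/negP => /(strictly_increasing_le ginc); lia.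
have Tex i : exists Ti : {linear X -> K^o}, [/\ continuous Ti,
    forall n, I i -> (g n <= i < g n.+1)%N -> Ti = S n (i - g n)%N &
    ~ I i \/ (i < g 0)%N -> forall x, Ti x = 0].
  have [[Ii g0]|nI] := pselect (I i /\ (g 0 <= i)%N).
    have [n _ ni] := block_ex _ _ g0; exists (S n (i - g n)%N); split.
    - by case: (SP n).
    - by move=> n' _ n'i; rewrite (block_uniq i n n').
    - by case=> [//|]; rewrite ltnNge g0.
  exists \0; split => [x|n Ii /andP[gi _]|//]; first exact: cvg_cst.
  exfalso; apply: nI; split => //; apply: leq_trans gi.
  exact: strictly_increasing_le.
have [T TP] := choice Tex.
have [||m Fm] := @uniform_boundedness_scalar T.
- by move=> i; case: (TP i).
- move=> x x1; pose B := [set i | 1 <= rnorm (T i x : K^o)].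
  suff : F (~` B) by apply: filterS => i /= /negP; rewrite -ltNge.
  pose b i := 1 <= rnorm (T i x : K^o).
  have b0 i : ~ I i \/ (i < g 0)%N -> b i = false.
    by move=> h; have [_ _ /(_ h x) Ti] := TP i; rewrite /b Ti /rnorm normr0 rp0 ler10.
  have cntg n : (count b (iota 0 (g n)) <= \sum_(j < n) kk j)%N.
    elim: n => [|n IHn].
      rewrite big_ord0 leqn0 (eq_in_count (a2 := pred0)) ?count_pred0// => i.
      by rewrite mem_iota /= => i0; apply: b0; right.
    have gn : (g n <= g n.+1)%N by apply: strictly_increasing_le.
    rewrite -(subnKC gn) iotaD count_cat add0n big_ord_recr /=; apply: leq_add => //.
    have [_ _ /(_ x x1)] := SP n; apply: leq_trans.
    rewrite -[X in iota X _]addn0 iotaDl count_map -/(L n).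
    apply: count_le_in => l; rewrite mem_iota add0n => /andP[_ lL] bl; have {}bl : b (g n + l)%N := bl.
    have Igl : I (g n + l)%N.
      by apply: contrapT => nI; move: bl; rewrite b0//; left.
    have [_ /(_ n Igl) TS _] := TP (g n + l)%N; move: bl; rewrite /b TS ?addKn//.
    by rewrite leq_addr /= -ltn_subRL.
  have qsum n : (\sum_(j < n.+1) kk j <= q n)%N.
    by apply: leq_sum => j _.
  have mono u v : (u <= v)%N -> (count b (iota 0 u) <= count b (iota 0 v))%N.
    by move=> uv; rewrite -(subnKC uv) iotaD count_cat leq_addr.
  (* If q n < p <= q (n + 1), the large indices below f p lie in the blocks 0 to n, so there are at
     most q n of them. *)
  have cnt p : (count b (iota 0 (f p)) <= p)%N.
    have ex : exists n, (p <= q n)%N by exists p; exact: strictly_increasing_ge.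
    case: (ex_minnP ex) => -[|n] pq nmin.
      have := mono _ _ (strictly_increasing_le finc pq); have := cntg 0%N.
      by rewrite big_ord0 /g; lia.
    have qp : (q n < p)%N by rewrite ltnNge; apply/negP => /nmin; rewrite ltnn.
    have := mono _ _ (strictly_increasing_le finc pq); have := cntg n.+1; have := qsum n.
    by rewrite /g; lia.
  have [Bu|/unboundedNfinite Bfin] := pselect (unbounded B); last first.
    by apply: F_free; rewrite setCK.
  have [eta [etainc etaB]] := unbounded_eta Bu.
  apply: contrapT => BF; apply: nB; exists B; split => //.
    by move=> i Bi; apply: contrapT => nI; have bi : b i := Bi; move: bi; rewrite b0//; left.
  (* Otherwise eta 0, ..., eta p would be p + 1 large indices below f p. *)
  exists eta => // p; rewrite leqNgt; apply/negP => etap.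
  have : (size (map eta (iota 0 p.+1)) <= size [seq i <- iota 0 (f p) | b i])%N.
    apply: uniq_leq_size.
      by rewrite map_inj_uniq ?iota_uniq//; exact: strictly_increasing_inj.
    move=> _ /mapP[k + ->]; rewrite mem_iota mem_filter mem_iota /= ltnS => kp.
    apply/andP; split; last exact: leq_ltn_trans (strictly_increasing_le etainc kp) etap.
    by have : B (eta k) by rewrite -etaB; exists k.
  by rewrite size_map size_iota size_filter => /leq_trans /(_ (cnt p)); rewrite ltnn.
apply: Ist; apply: filterS (filterI Fm (free_filter_ge (g m))) => i [/= Tim gi] Ii.
have [n mn gin] := block_ex _ _ gi.
have [_ /(_ n Ii gin) TS _] := TP i; have [_ /(_ (i - g n)%N) Sn _] := SP n.
have [|x x1 Sx] := Sn; first by rewrite /L; lia.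
have := Tim x x1; rewrite TS ltNge => /negP; apply; apply: le_trans Sx.
by rewrite ler_nat leqW.
Qed.

End necessity.

(** * Sufficiency for Frechet spaces *)

Section independent_choice.

Lemma geometric_half (M : nat) : \sum_(n < M) 2^-1 ^+ n.+1 = 1 - 2^-1 ^+ M :> rat.
Proof.
elim: M => [|M IHM]; first by rewrite big_ord0 expr0 subrr.
by rewrite big_ord_recr /= IHM exprS; set x := _ ^+ M; field.
Qed.

(* The tuples c with c m < 2 ^ (m + 1) that are bad for n make up a fraction at
   most 2 ^ - (n + 1) of all tuples, so that some tuple is never bad. *)
Lemma avoid_one_per_line (M : nat) (bad : nat -> (nat -> nat) -> Prop) :
  (forall n (c c' : nat -> nat), (n < M)%N -> (forall m, m != n -> c m = c' m) ->
    bad n c -> bad n c' -> c n = c' n) ->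
  exists2 c : nat -> nat, forall m, (c m < 2 ^ m.+1)%N & forall n, (n < M)%N -> ~ bad n c.
Proof.
move=> badP; apply: contrapT => nex.
pose tup (c : {ffun 'I_M -> 'I_(2 ^ M)}) (m : nat) : nat :=
  oapp (fun i : 'I_M => c i : nat) 0%N (insub m).
have tupE c (i : 'I_M) : tup c i = c i by rewrite /tup valK.
pose fam := family (fun m : 'I_M => [pred v : 'I_(2 ^ M) | (v < 2 ^ m.+1)%N]).
pose fam0 (n : 'I_M) := family (fun m : 'I_M =>
  [pred v : 'I_(2 ^ M) | if m == n then v == 0%N :> nat else (v < 2 ^ m.+1)%N]).
pose P := (\prod_(m < M) 2 ^ m.+1)%N.
pose W (n : 'I_M) := (\prod_(m < M | m != n) 2 ^ m.+1)%N.
have card_lt (m : 'I_M) : #|[pred v : 'I_(2 ^ M) | (v < 2 ^ m.+1)%N]| = (2 ^ m.+1)%N.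
  have le : (2 ^ m.+1 <= 2 ^ M)%N by rewrite leq_exp2l.
  by rewrite -sum1_card -(big_ord_widen _ (fun=> 1%N))// sum1_card card_ord.
have M2 : (0 < 2 ^ M)%N by rewrite expn_gt0.
have card_fam : #|fam| = P.
  by rewrite card_family foldrE big_image /=; apply: eq_bigr => m _; exact: card_lt.
have card_fam0 n : #|fam0 n| = W n.
  rewrite card_family foldrE big_image /= /W [RHS]big_mkcond /=; apply: eq_bigr => m _.
  case: (altP (m =P n)) => [->|mn] /=; last exact: card_lt.
  apply: (@eq_trans _ _ #|pred1 (Ordinal M2)|); last exact: card1.
  by apply: eq_card => v; rewrite !inE.
have WP n : (W n * 2 ^ n.+1 = P)%N by rewrite /P (bigD1 n)//= mulnC.
pose B n := [set c in fam | `[< bad n (tup c) >]].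
have cardB (n : 'I_M) : (#|B n| <= W n)%N.
  pose z (c : {ffun 'I_M -> 'I_(2 ^ M)}) := [ffun m => if m == n then Ordinal M2 else c m].
  (* Setting coordinate n to 0 is injective on [B n], since by [badP] that coordinate is determined
     by the others. *)
  rewrite -card_fam0 -(@card_in_imset _ _ z (mem (B n))); last first.
    move=> c c' /[!inE] /andP[_ /asboolP bc] /andP[_ /asboolP bc'] zz.
    have cm (m : 'I_M) : m != n -> c m = c' m.
      by move=> mn; have := congr1 (fun g : {ffun _} => g m) zz; rewrite !ffunE (negbTE mn).
    apply/ffunP => m; have [->|/cm//] := eqVneq m n; apply: val_inj => /=.
    rewrite -!tupE; apply: badP bc bc' => // k kn.
    by rewrite /tup; case: insubP => //= i _ ik; rewrite cm// -val_eqE /= ik.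
  apply/subset_leq_card/fintype.subsetP => _ /imsetP[c /[!inE] /andP[/familyP cf _] ->].
  apply/familyP => m; rewrite ffunE; have := cf m; rewrite !inE.
  by case: (altP (m =P n)).
have : (P <= \sum_(n < M) W n)%N.
  rewrite -card_fam; apply: (@leq_trans (\sum_(n < M) #|B n|)); last exact: leq_sum.
  apply: (@leq_trans (\sum_(c in fam) \sum_(n < M) (c \in B n))).
    rewrite -sum1_card; apply: leq_sum => c cfam.
    have [n bn] : exists n : 'I_M, bad n (tup c).
      apply: contrapT => nb; apply: nex; exists (tup c).
        move=> m; rewrite /tup; case: insubP => /= [i _ <-|_]; last by rewrite expn_gt0.
        by have /familyP := cfam; apply.
      by move=> n nM bn; apply: nb; exists (Ordinal nM).
    rewrite (bigD1 n)//= (_ : c \in B n); first exact: leq_addr.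
    by rewrite inE cfam; apply/asboolP.
  rewrite exchange_big /=; apply: leq_sum => n _.
  rewrite -sum1_card big_mkcond [leqRHS]big_mkcond /=; apply: leq_sum => c _.
  by case: (c \in fam) => //; case: (c \in B n).
have : (\sum_(n < M) W n < P)%N.
  rewrite -(ltr_nat rat) natr_sum.
  have -> : \sum_(n < M) (W n)%:R = P%:R * (1 - 2^-1 ^+ M) :> rat.
    rewrite -geometric_half mulr_sumr; apply: eq_bigr => n _.
    by rewrite -(WP n) natrM natrX -mulrA -exprMn divff ?expr1n ?mulr1.
  rewrite mulrBr mulr1 gtrBl mulr_gt0 ?exprn_gt0// ltr0n prodn_gt0// => m.
  by rewrite expn_gt0.
lia.
Qed.
End independent_choice.

Section sufficiency.

(** Compactness of a product of finite sets: [l] is the coordinatewise limit along an ultrafilter,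
    and finitely many coordinates agree with it simultaneously for arbitrarily large M. *)
Lemma finite_koenig (b : nat -> nat) (c : nat -> nat -> nat) :
  (forall M m, (c M m < b m)%N) ->
  exists l : nat -> nat, (forall m, (l m < b m)%N) /\
    forall J, exists2 M, (J <= M)%N & forall m, (m < J)%N -> c M m = l m.
Proof.
move=> cb; have [U [UU ooU]] := @ultraFilterLemma nat \oo _.
have FU : ProperFilter U by exact: ultra_proper.
have lim m : exists v, (v < b m)%N /\ U [set M | c M m = v].
  have : U [set M | (c M m < b m)%N] by apply: filterE => M; exact: cb.
  elim: (b m) => [|k IHk].
    by move=> U0; exfalso; have [M] := filter_ex U0.
  move=> Uk; have [Uv|nUv] := in_ultra_setVsetC [set M | c M m = k] UU.
    by exists k.
  have [|v [vk Uv]] := IHk.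
    by apply: filterS (filterI Uk nUv) => M [/= + ne]; rewrite ltnS leq_eqVlt => /orP[/eqP|].
  by exists v; split => //; exact: ltnW.
have [l lP] := choice lim; exists l; split => [m|J]; first by case: (lP m).
have : U [set M | forall m, (m < J)%N -> c M m = l m].
  elim: J => [|J IHJ]; first by apply: filterE.
  have [_ UJ] := lP J; apply: filterS (filterI IHJ UJ) => M [/= h cJ] m.
  by rewrite ltnS leq_eqVlt => /orP[/eqP ->//|/h].
move=> UJ; have /ooU UJ' : \oo [set M | (J <= M)%N] by exists J.
by have [M [/= h JM]] := filter_ex (filterI UJ UJ'); exists M.
Qed.

Section dilations.
Variables (K : numFieldType) (Y : tvsType K).

Definition dilate (W : set Y) (t : K) : set Y := [set y | W (t^-1 *: y)].

(** Intersect a convex neighbourhood with its negative. Convexity is recorded as sW + tW being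
    contained in (s + t)W, which replaces a gauge. *)
Lemma symmetric_convex_nbhs (V : set Y) : nbhs 0 V -> exists W : set Y,
  [/\ nbhs 0 W, W `<=` V, forall y, W y -> W (- y) &
      forall y z s t, 0 < s -> 0 < t -> dilate W s y -> dilate W t z -> dilate W (s + t) (y + z)].
Proof.
move=> V0; have [B Bconv [Bopen Bbasis]] := @locally_convex K Y.
have [C [BC C0] CV] := Bbasis 0 V V0.
have nC : nbhs (0 : Y) C by apply: open_nbhs_nbhs; split => //; exact: Bopen.
have convC y z (l : K) : 0 <= l -> l <= 1 -> C y -> C z -> C (l *: y + (1 - l) *: z).
  move=> l0 l1 Cy Cz; have := Bconv C (mem_set BC) y z (Itv01 l0 l1) (mem_set Cy) (mem_set Cz).
  by move=> /set_mem.
have convC2 y z s t : 0 < s -> 0 < t -> C (s^-1 *: y) -> C (t^-1 *: z) ->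
    C ((s + t)^-1 *: (y + z)).
  move=> s0 t0 Cy Cz; have st0 : 0 < s + t by exact: addr_gt0.
  have := convC _ _ (s / (s + t)) _ _ Cy Cz.
  have -> : 1 - s / (s + t) = t / (s + t) by field; rewrite gt_eqF.
  rewrite !scalerA mulrAC divff ?gt_eqF// mul1r mulrAC divff ?gt_eqF// mul1r -scalerDr.
  apply; first by rewrite divr_ge0// ltW.
  by rewrite ler_pdivrMr// mul1r lerDl ltW.
exists (C `&` [set y | C (- y)]); split.
- apply: filterI => //; have : (- (y : Y)) @[y --> (0 : Y)] --> - (0 : Y) by exact: opp_continuous.
  by rewrite oppr0; apply.
- by move=> y [/CV].
- by move=> y [Cy CNy]; split => //=; rewrite opprK.
- move=> y z s t s0 t0 [Cy /= CNy] [Cz /= CNz]; split; first exact: convC2.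
  rewrite /= -scalerN opprD; apply: convC2 => //; by rewrite scalerN.
Qed.

End dilations.

Section main.
Variables (R : realType) (K : numFieldType) (D : real_form R K).
Variables (F : set_system nat) (FF : ProperFilter F) (F_free : free_filter F).
Variables (X : tvsType K).
Hypothesis frX : frechet R X.

Theorem ubp_frechet : rapid_plus_filter F -> P_plus_filter F ->
  uniform_boundedness_principle F X.
Proof.
move=> Frapid FP Y T Tcont Tpb V0 V0nbhs.
have [W [W0 WV WN WD]] := symmetric_convex_nbhs V0nbhs.
case: frX => d [d0 dC dT [dtrans dnbhs dcomp]].
pose g x := d 0 x.
have gd x y : d x y = g (y - x) by rewrite -(dtrans x y (- x)) subrr.
have g0 : g 0 = 0 by apply/eqP; rewrite d0 eqxx.
have gN x : g (- x) = g x by rewrite /g -(dtrans _ _ x) add0r addNr dC.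
have gD x y : g (x + y) <= g x + g y.
  rewrite {1}/g; apply: le_trans (dT 0 x _) _; rewrite lerD2l gd.
  by rewrite addrAC subrr add0r.
have g_ge0 x : 0 <= g x by have := gD x (- x); rewrite subrr g0 gN; lra.
have gMn x k : g (x *+ k) <= k%:R * g x.
  elim: k => [|k IHk]; first by rewrite mulr0n g0 mul0r.
  by rewrite mulrSr -natr1 mulrDl mul1r; have := gD (x *+ k) x; lra.
have Wzero : W 0 by exact: nbhs_singleton.
have D0 t : dilate W t 0 by rewrite /dilate /= scaler0.
have Dle s t y : 0 < s -> s <= t -> dilate W s y -> dilate W t y.
  rewrite le_eqVlt => s0 /orP[/eqP -> //|st] Wy.
  by rewrite -(subrKC s t) -[y]addr0; apply: WD => //; rewrite subr_gt0.
have DN t y : dilate W t y -> dilate W t (- y).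
  by rewrite /dilate /= scalerN; exact: WN.
have DMn t y k : 0 < t -> (0 < k)%N -> dilate W t (y *+ k) -> dilate W t y.
  move=> t0 k0 Wy; have k0' : 0 < k%:R :> K by rewrite ltr0n.
  apply: (Dle (t / k%:R)); first exact: divr_gt0.
    by rewrite ler_pdivrMr// ler_peMr ?ler1n// ltW.
  by rewrite /dilate /= invfM invrK -scalerA scaler_nat.
apply: contrapT => nequi.
have g_nbhs e : 0 < e -> nbhs (0 : X) [set x | g x < e].
  by move=> e0; apply/dnbhs; exists e.
(* With coefficients below 2 ^ (k + 1) the k-th term of the series has size at most 2 ^ - (k +
   1). *)
pose r k : R := 4^-1 ^+ k.+1.
have r0 k : 0 < r k by rewrite exprn_gt0// invr_gt0.
(* Twice k + 1: if two sums differing only in their k-th coefficient both have image in (k + 1)W,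
   the images differ by an element of (2k + 2)W. *)
pose w k : K := (k.+1).*2%:R.
have w0 k : 0 < w k by rewrite ltr0n.
pose A k := [set i | exists2 x, g x < r k & ~ dilate W (w k) (T i x)].
have AS k : A k.+1 `<=` A k.
  move=> i [x xr nx]; exists x.
    apply: lt_trans xr _; rewrite /r [ltLHS]exprS gtr_pMl ?exprn_gt0 ?invr_gt0//.
    by rewrite invf_lt1// ltr1n.
  by apply: contra_not nx; apply: Dle => //; rewrite ler_nat; lia.
have Ast k : stationary F (A k).
  move=> FA; apply: nequi.
  have wk0 : 0 < (k.+1).*2%:R :> R by rewrite ltr0n.
  exists [set x | g x < r k / (k.+1).*2%:R]; first by apply: g_nbhs; rewrite divr_gt0.
  apply: filterS FA => i /= nA _ [x xg <-]; apply: WV.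
  have : dilate W (w k) (T i (x *+ (k.+1).*2)).
    apply: contrapT => nW; apply: nA; exists (x *+ (k.+1).*2) => //.
    by apply: le_lt_trans (gMn _ _) _; rewrite mulrC -ltr_pdivlMr.
  by rewrite /dilate /= raddfMn /= -scaler_nat scalerA mulVf ?scale1r// gt_eqF.
have [B Bst BA] := FP A AS Ast.
have [h hP] : {h : nat -> nat & forall k i, B i -> (h k <= i)%N -> A k i}.
  apply: (@choice _ _ (fun k h => forall i, B i -> (h <= i)%N -> A k i)) => k.
  have : ~ unbounded (B `\` A k) by move=> /unbounded_infinite; apply; exact: BA.
  move=> /existsNP[n hn]; exists n.+1 => i Bi ni; apply: contrapT => nA.
  by apply: hn; exists i.
(* Rapidity will give b n >= f n >= h n, which puts b n into [A n]. *)
pose f n := (\sum_(k < n.+1) (h k).+1)%N.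
have finc : strictly_increasing f.
  by apply: strictly_increasingP => n; rewrite /f [ltnRHS]big_ord_recr /= addnS ltnS leq_addr.
have hf n : (h n <= f n)%N by rewrite /f big_ord_recr /=; lia.
have [B' [B'st B'B [b [binc brange] fb]]] := Frapid B f Bst finc.
have bA n : A n (b n).
  by apply: hP; [apply: B'B; rewrite -brange; exists n|exact: leq_trans (hf n) (fb n)].
have [x xP] : {x : nat -> X & forall n, g (x n) < r n /\ ~ dilate W (w n) (T (b n) (x n))}.
  by apply: (@choice _ _ (fun n x => g x < r n /\ ~ dilate W (w n) (T (b n) x))) => n;
    have [z ? ?] := bA n; exists z.
pose bad M n c := dilate W n.+1%:R (T (b n) (\sum_(0 <= m < M) x m *+ c m)).
have line M n (c c' : nat -> nat) : (n < M)%N -> (forall m, m != n -> c m = c' m) ->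
    bad M n c -> bad M n c' -> (c n <= c' n)%N.
  move=> nM cc' bc bc'; rewrite leqNgt; apply/negP => lt; have [_] := xP n; apply.
  apply: (@DMn _ _ (c n - c' n)%N); [exact: w0|by rewrite subn_gt0|].
  have -> : w n = n.+1%:R + n.+1%:R by rewrite /w -addnn natrD.
  have -> : T (b n) (x n) *+ (c n - c' n) =
      T (b n) (\sum_(0 <= m < M) x m *+ c m) - T (b n) (\sum_(0 <= m < M) x m *+ c' m).
    rewrite -raddfB -raddfMn /=; congr (T (b n) _).
    rewrite !big_mkord (bigD1 (Ordinal nM))//= [X in _ - X](bigD1 (Ordinal nM))//=.
    rewrite (eq_bigr (fun i : 'I_M => x i *+ c' i)); last first.
      by move=> i ni; rewrite cc'.
    by rewrite opprD addrACA subrr addr0 mulrnBr// ltnW.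
  by apply: WD; rewrite ?ltr0n//; exact: DN.
have ex M : exists c : nat -> nat, (forall m, (c m < 2 ^ m.+1)%N) /\ forall n, (n < M)%N -> ~ bad M n c.
  have [|c c1 c2] := @avoid_one_per_line M (bad M); last by exists c.
  move=> n c c' nM cc' bc bc'; apply/eqP; rewrite eqn_leq (line M n c c')//=.
  by apply: (line M n c' c) => // m mn; rewrite cc'.
have [C CP] := choice ex.
have [l [lb lP]] := @finite_koenig (fun m => 2 ^ m.+1)%N C (fun M => (CP M).1).
have gx m k : (k < 2 ^ m.+1)%N -> g (x m *+ k) <= 2^-1 ^+ m.+1.
  move=> kb; apply: le_trans (gMn _ _) _; have [xr _] := xP m.
  apply: (@le_trans _ _ ((2 ^ m.+1)%:R * r m)).
    apply: ler_pM => //; last exact: ltW.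
    by rewrite ler_nat ltnW.
  rewrite /r natrX -exprMn lerXn2r ?nnegrE//; lra.
have tail (c : nat -> nat) J M : (forall m, (c m < 2 ^ m.+1)%N) -> (J <= M)%N ->
    g (\sum_(J <= m < M) x m *+ c m) <= 2^-1 ^+ J.
  move=> cb JM; apply: (@le_trans _ _ (2^-1 ^+ J - 2^-1 ^+ M)); last first.
    by rewrite lerBlDr lerDl exprn_ge0.
  elim: M JM => [|M IHM]; first by rewrite leqn0 => /eqP ->; rewrite big_geq// g0 subrr.
  rewrite leq_eqVlt => /orP[/eqP ->|]; first by rewrite big_geq// g0 subrr.
  rewrite ltnS => JM; rewrite big_nat_recr//=; apply: le_trans (gD _ _) _.
  have := IHM JM; have := gx M (c M) (cb M).
  have -> : 2^-1 ^+ M = 2 * 2^-1 ^+ M.+1 :> R by rewrite [in RHS]exprS mulrA divff ?mul1r.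
  lra.
have half (e : R) : 0 < e -> exists J : nat, 2^-1 ^+ J < e.
  move=> e0; exists (Num.trunc e^-1).+1; set J := _.+1.
  rewrite exprVn -[ltRHS]invrK ltf_pV2 ?posrE ?invr_gt0 ?exprn_gt0//.
  apply: lt_trans (truncnS_gt _) _; rewrite -natrX ltr_nat; exact: ltn_expl.
pose s M := \sum_(0 <= m < M) x m *+ l m.
have sJM J M : (J <= M)%N -> d (s J) (s M) <= 2^-1 ^+ J.
  move=> JM; rewrite gd /s (big_cat_nat (n := J))//= addrAC subrr add0r.
  exact: tail.
have [e e0|z sz] := dcomp s.
  have [J Je] := half e e0; exists J => m n Jm Jn.
  wlog mn : m n Jm Jn / (m <= n)%N.
    by move=> wl; have [/wl|/ltnW /wl] := leqP m n; [|rewrite dC]; exact.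
  apply: le_lt_trans (sJM _ _ mn) _; apply: le_lt_trans Je.
  by apply: ler_wiXn2l => //; lra.
have sz' J : d (s J) z <= 2^-1 ^+ J.
  apply/ler_addgt0Pr => e e0.
  have : nbhs z [set y | d z y < e] by apply/dnbhs; exists e.
  move=> /sz[N _ NP]; have := NP (maxn N J); rewrite /= leq_maxl => /(_ isT) zN.
  apply: le_trans (dT _ (s (maxn N J)) _) _; apply: lerD; first by apply: sJM; exact: leq_maxr.
  by rewrite dC ltW.
(* By continuity of T (b n), late good partial sums differ from [z] by vectors with image in W / 2.
   Since 1 / 2 + (n + 1) / 2 <= n + 1, half of the lower bound survives in the limit. *)
have big n : ~ dilate W (n.+1%:R / 2) (T (b n) z).
  move=> Wz; have n0 : 0 < n.+1%:R / 2 :> K by rewrite divr_gt0.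
  have : nbhs (0 : X) (T (b n) @^-1` W).
    by apply: (Tcont (b n) 0); rewrite raddf0.
  move=> /dnbhs[e e0 eW].
  have [J Je] := half (e / 4) (divr_gt0 e0 (ltr0Sn _ _)).
  have [M JM CM] := lP (maxn J n.+1).
  have JM' : (J <= M)%N by apply: leq_trans JM; exact: leq_maxl.
  have nM : (n < M)%N by apply: leq_trans JM; exact: leq_maxr.
  have [Cb /(_ n nM)] := CP M; apply.
  pose v := \sum_(0 <= m < M) x m *+ C M m - z.
  have gv : g v <= 2^-1 ^+ J + 2^-1 ^+ J.
    rewrite /v (big_cat_nat (n := J))//=.
    have -> : \sum_(0 <= m < J) x m *+ C M m = s J.
      by apply: eq_big_nat => m /andP[_ mJ]; rewrite CM// (leq_trans mJ)// leq_maxl.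
    rewrite addrAC addrC; apply: le_trans (gD _ _) _; apply: lerD; first exact: tail.
    by rewrite -gd dC.
  have Wv : dilate W 2^-1 (T (b n) v).
    rewrite /dilate /= invrK scaler_nat -raddfMn /=; apply: eW => /=.
    by rewrite -/(g _); apply: le_lt_trans (gMn _ _) _; lra.
  rewrite /bad -[X in T (b n) X](subrK z) -/v raddfD /=.
  apply: (Dle (2^-1 + n.+1%:R / 2)); first by rewrite addr_gt0.
    have -> : 2^-1 + n.+1%:R / 2 = (1 + n.+1%:R) / 2 :> K by field.
    by rewrite ler_pdivrMr// mulr_natr mulr2n lerD2r ler1n.
  by apply: WD => //; rewrite invr_gt0.
(* For n >= n0 > 2 / t, membership of T (b n) z in W / t would contradict [big]; so [F]-almost all
   indices avoid [B'], which is stationary. *)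
have [t t0 Ft] := Tpb z W W0.
have [n0 n0t] := archimedean_scalar D (ltW (divr_gt0 (ltr0Sn K 1) t0)).
apply: B'st; apply: filterS (filterI Ft (free_filter_ge F_free (b n0))) => i [/= Wi bi] Bi.
move: Bi; rewrite -brange => -[n _ nE].
have n0n : (n0 <= n)%N.
  by rewrite leqNgt; apply/negP => /binc; rewrite nE ltnNge bi.
apply: (big n); rewrite nE; apply: (Dle t^-1); first by rewrite invr_gt0.
  rewrite ler_pdivlMr// mulrC ltW//; apply: lt_le_trans n0t _.
  by rewrite ler_nat leqW.
by rewrite /dilate /= invrK.
Qed.

End main.
End sufficiency.

(** * The Banach space of bounded sequences *)

Section complete_normed.
Variables (R : realType) (K : numFieldType) (D : real_form R K).
Local Notation rnorm := (rnorm D).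

Lemma rnorm_scalarE (z : K) : rnorm (z : K^o) = rp D `|z|.
Proof. by []. Qed.

Lemma rnorm_distC (V : normedModType K) (x y : V) : rnorm (x - y) = rnorm (y - x).
Proof. by rewrite /rnorm distrC. Qed.

Lemma nbhs_rnorm (V : normedModType K) (x : V) (A : set V) :
  nbhs x A <-> exists2 e : R, 0 < e & [set y | rnorm (x - y) < e] `<=` A.
Proof.
split=> [/nbhs_ballP[e /= e0 eA]|[e e0 eA]].
  exists (rp D e); first exact: rp_gt0.
  move=> y /= xy; apply: eA; rewrite -ball_normE /=.
  by rewrite -(emb_pos D (ltW e0)) rnorm_lt.
apply/nbhs_ballP; exists (emb D e); first by rewrite /= emb_gt0.
by move=> y; rewrite -ball_normE /= rnorm_lt; exact: eA.
Qed.

Lemma cauchy_rnorm (V : completeNormedModType K) (u : nat -> V) :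
  (forall e : R, 0 < e ->
    exists N, forall m n, (N <= m)%N -> (N <= n)%N -> rnorm (u m - u n) < e) ->
  exists l : V, u @ \oo --> l.
Proof.
move=> uC; have : cauchy (u @ \oo).
  apply/cauchy_exP => e e0; have [N NP] := uC (rp D e) (rp_gt0 D e0).
  exists (u N); exists N => // n /= Nn; rewrite -ball_normE /=.
  by rewrite -(emb_pos D (ltW e0)) rnorm_lt; apply: NP.
move=> uc; have ul : cvg (u @ \oo) by exact: cauchy_cvg.
by exists (lim (u @ \oo)).
Qed.

Lemma banach_frechet (V : completeNormedModType K) : frechet R V.
Proof.
exists (fun x y => rnorm (x - y)); split.
- move=> x y; apply/eqP/eqP => [/rnorm_eq0/eqP|->]; first by rewrite subr_eq0 => /eqP.
  by rewrite subrr /rnorm normr0 rp0.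
- exact: rnorm_distC.
- by move=> x y z; apply: le_trans (rnormD _ _ _); rewrite addrA subrK.
- split; [|exact: nbhs_rnorm|exact: cauchy_rnorm].
  by move=> x y z; rewrite opprD addrACA subrr addr0.
Qed.

(** Completeness of [K] comes from that of [R] through the real coordinates [rp z] and
    [rp (phase D * z)], recombined by [rp_decomp]. *)
Lemma scalar_cauchy (u : nat -> K^o) :
  (forall e : R, 0 < e ->
    exists N, forall m n, (N <= m)%N -> (N <= n)%N -> rnorm (u m - u n : K^o) < e) ->
  exists l : K^o, forall e : R, 0 < e -> exists N, forall n, (N <= n)%N -> rnorm (l - u n : K^o) < e.
Proof.
move=> uC.
have part (k : K) : `|k| <= 1 -> exists a : R, forall e : R, 0 < e ->
    exists N, forall n, (N <= n)%N -> `|a - rp D (k * u n)| < e.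
  move=> k1; have : cauchy ((fun n => rp D (k * u n)) @ \oo).
    apply/cauchy_exP => e e0; have [N NP] := uC e e0.
    exists (rp D (k * u N)); exists N => // n /= Nn; rewrite -ball_normE /=.
    apply: le_lt_trans (NP N n _ Nn) => //.
    rewrite -rpN -rpD -mulrN -mulrDr; apply: le_trans (rp_norm D _) _.
    by rewrite /rnorm normrM rp_le ?mulr_ge0// ler_piMl.
  move=> uc; have ua : cvg ((fun n => rp D (k * u n)) @ \oo) by exact: cauchy_cvg.
  exists (lim ((fun n => rp D (k * u n)) @ \oo)) => e e0.
  by have /cvgrPdist_lt /(_ e e0)[N _ NP] := ua; exists N.
have [|a aP] := part 1; first by rewrite normr1.
have [|b bP] := part (phase D); first by rewrite norm_phase.
exists (emb D a + cophase D * emb D b) => e e0.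
have e20 : 0 < e / 2 by rewrite divr_gt0.
have [N1 h1] := aP _ e20; have [N2 h2] := bP _ e20.
exists (maxn N1 N2) => n; rewrite geq_max => /andP[/h1 {}h1 /h2 {}h2].
rewrite [u n](rp_decomp D) opprD addrACA -rmorphB -mulrBr -rmorphB.
apply: le_lt_trans (rnormD D (_ : K^o) (_ : K^o)) _.
rewrite mul1r in h1; rewrite [e]splitr; apply: ltrD.
  by rewrite rnorm_scalarE norm_emb rpK.
apply: le_lt_trans h2; rewrite rnorm_scalarE normrM norm_emb -[leRHS](rpK D) rp_le ?mulr_ge0 ?emb_ge0//.
by rewrite ler_piMl ?emb_ge0 ?norm_cophase.
Qed.

(** A Cauchy filter contains balls of radius 1 / (k + 1), and it converges to the limit of their
    centres. *)
Lemma complete_of_sequences (V : normedModType K) :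
  (forall u : nat -> V, (forall e : R, 0 < e ->
      exists N, forall m n, (N <= m)%N -> (N <= n)%N -> rnorm (u m - u n) < e) ->
    exists l : V, forall e : R, 0 < e ->
      exists N, forall n, (N <= n)%N -> rnorm (l - u n) < e) ->
  forall F : set_system V, ProperFilter F -> cauchy F -> cvg F.
Proof.
move=> Vc F FF /cauchyP Fc.
pose r (k : nat) : R := k.+1%:R^-1.
have r0 k : 0 < r k by rewrite invr_gt0.
have [u uP] : {u : nat -> V & forall k, F (ball (u k) (emb D (r k)))}.
  apply: (@choice _ _ (fun k x => F (ball x (emb D (r k))))) => k.
  by apply: Fc; rewrite emb_gt0.
have r_lt (e : R) : 0 < e -> exists N, forall k, (N <= k)%N -> r k < e.
  move=> e0; exists (Num.trunc e^-1) => k Nk.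
  rewrite /r -[ltRHS]invrK ltf_pV2 ?posrE ?invr_gt0//.
  by apply: lt_le_trans (truncnS_gt _) _; rewrite ler_nat ltnS.
have [e e0|l lP] := Vc u.
  have [N NP] := r_lt (e / 2) (divr_gt0 e0 (ltr0Sn _ _)).
  exists N => m n Nm Nn; have [x [xm xn]] := filter_ex (filterI (uP m) (uP n)).
  rewrite -(subrKA x) [e]splitr; apply: le_lt_trans (rnormD _ _ _) _.
  move: xm xn; rewrite (rnorm_distC x) -!ball_normE /= !rnorm_lt => xm xn.
  by apply: ltrD; [apply: lt_trans xm (NP m Nm)|apply: lt_trans xn (NP n Nn)].
apply/cvg_ex; exists l => A /nbhs_rnorm[e e0 eA].
have e20 : 0 < e / 2 by rewrite divr_gt0.
have [N NP] := r_lt _ e20; have [M MP] := lP _ e20.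
pose k := maxn N M; apply: filterS (uP k) => y; rewrite -ball_normE /= rnorm_lt => ky.
apply: eA => /=; rewrite -(subrKA (u k)) [e]splitr; apply: le_lt_trans (rnormD _ _ _) _.
apply: ltrD; first by apply: MP; exact: leq_maxr.
by apply: lt_trans ky _; apply: NP; exact: leq_maxl.
Qed.

End complete_normed.

Section linf.
Variables (R : realType) (K : numFieldType) (D : real_form R K).

Definition linf_pred : {pred nat -> K^o} :=
  fun u => `[< exists C : R, forall n, rnorm D (u n) <= C >].

Record linf := Linf { linf_val :> nat -> K^o; _ : linf_pred linf_val }.

HB.instance Definition _ := [isSub for linf_val].
HB.instance Definition _ := [Choice of linf by <:].

Lemma linf_submod_closed : submod_closed linf_pred.
Proof.
split; first by apply/asboolP; exists 0 => n; rewrite /rnorm normr0 rp0.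
move=> a u v /asboolP[C uC] /asboolP[C' vC]; apply/asboolP.
exists (rp D `|a| * C + C') => n; apply: le_trans (rnormD _ _ _) _.
apply: lerD => //; rewrite rnormZ; apply: ler_wpM2l => //.
by rewrite rp_ge0.
Qed.

HB.instance Definition _ := GRing.isSubmodClosed.Build K (nat -> K^o) linf_pred linf_submod_closed.
HB.instance Definition _ := [SubChoice_isSubLmodule of linf by <:].

Lemma linf_bound (u : linf) : exists C : R, forall n, rnorm D (u n) <= C.
Proof. by case: u => u /= /asboolP. Qed.

Definition linf_rnorm (u : linf) : R := sup [set rnorm D (u n) | n in setT].

Definition linf_norm (u : linf) : K := emb D (linf_rnorm u).

Lemma linf_rnorm_le (u : linf) (C : R) :
  linf_rnorm u <= C <-> forall n, rnorm D (u n) <= C.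
Proof.
split=> [uC n|uC].
  apply: le_trans uC; apply: ub_le_sup; last by exists n.
  by have [C' uC'] := linf_bound u; exists C' => _ [k _ <-].
apply: ge_sup; first by exists (rnorm D (u 0%N)), 0%N.
by move=> _ [k _ <-].
Qed.

Lemma le_linf_rnorm (u : linf) n : rnorm D (u n) <= linf_rnorm u.
Proof. by move: n; apply/linf_rnorm_le. Qed.

Lemma linf_rnorm_ge0 (u : linf) : 0 <= linf_rnorm u.
Proof. by apply: le_trans (le_linf_rnorm u 0%N); exact: rnorm_ge0. Qed.

Lemma linf_normD (u v : linf) : linf_norm (u + v) <= linf_norm u + linf_norm v.
Proof.
rewrite /linf_norm -rmorphD emb_le; apply/linf_rnorm_le => n.
by apply: le_trans (rnormD _ _ _) _; apply: lerD; exact: le_linf_rnorm.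
Qed.

Lemma linf_normZ (a : K) (u : linf) : linf_norm (a *: u) = `|a| * linf_norm u.
Proof.
have le (b : K) (v : linf) : linf_rnorm (b *: v) <= rp D `|b| * linf_rnorm v.
  apply/linf_rnorm_le => n; rewrite [rnorm D _]rnormZ ler_wpM2l ?rp_ge0//.
  exact: le_linf_rnorm.
have [->|a0] := eqVneq a 0.
  rewrite normr0 mul0r /linf_norm -[RHS](rmorph0 (emb D)); congr (emb D _); apply/eqP.
  by rewrite eq_le linf_rnorm_ge0 andbT; apply: le_trans (le _ _) _; rewrite normr0 rp0 mul0r.
rewrite -[`|a|](emb_pos D)// /linf_norm -rmorphM; congr (emb D _).
apply/eqP; rewrite eq_le le /=.
have := le a^-1 (a *: u); rewrite scalerA mulVf// scale1r.
move=> /(ler_wpM2l (rp_ge0 D (normr_ge0 a))).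
by rewrite mulrA -rpM// -normrM divff// normr1 rp1 mul1r.
Qed.

Lemma linf_norm_eq0 (u : linf) : linf_norm u = 0 -> u = 0.
Proof.
rewrite -(rmorph0 (emb D)) => /emb_inj u0; apply: val_inj; apply/funext => n /=.
apply: (@rnorm_eq0 _ _ D); apply/eqP; rewrite eq_le rnorm_ge0 andbT -u0.
exact: le_linf_rnorm.
Qed.

HB.instance Definition _ :=
  Lmodule_isNormed.Build K linf linf_normD linf_normZ linf_norm_eq0.

Lemma linf_normE (u : linf) : `|u| = linf_norm u. Proof. by []. Qed.

Lemma linf_complete (F : set_system linf) : ProperFilter F -> cauchy F -> cvg F.
Proof.
move=> FF FC; apply: (@complete_of_sequences R K D linf) FC => u uC.
have rE (v : linf) : rnorm D v = linf_rnorm v by rewrite /rnorm linf_normE rpK.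
have coord n : exists l : K^o, forall e : R, 0 < e ->
    exists N, forall k, (N <= k)%N -> rnorm D (l - u k n : K^o) < e.
  apply: scalar_cauchy => e e0; have [N NP] := uC e e0; exists N => i j Ni Nj.
  apply: le_lt_trans (NP i j Ni Nj); rewrite rE.
  exact: (le_linf_rnorm (u i - u j) n).
have [l lP] := choice coord.
(* The Cauchy estimate is the same for all coordinates, so the coordinatewise limit is uniform. *)
have unif (e : R) : 0 < e -> exists N, forall k, (N <= k)%N ->
    forall n, rnorm D (l n - u k n : K^o) <= e.
  move=> e0; have [N NP] := uC e e0; exists N => k Nk n.
  apply/ler_addgt0Pr => h h0; have [M MP] := lP n h h0.
  pose j := maxn N M; rewrite -(subrKA (u j n : K^o)) addrC.
  apply: le_trans (rnormD _ _ _) _; apply: lerD.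
    apply: le_trans (ltW (NP j k (leq_maxl _ _) Nk)); rewrite rE.
    exact: (le_linf_rnorm (u j - u k) n).
  by apply: ltW; apply: MP; exact: leq_maxr.
have lin : linf_pred l.
  have [N NP] := unif 1 ltr01; have [C uC'] := linf_bound (u N).
  apply/asboolP; exists (1 + C) => n; rewrite -[l n](subrK (u N n : K^o)).
  by apply: le_trans (rnormD _ _ _) _; apply: lerD => //; exact: NP.
exists (Linf lin) => e e0.
have e20 : 0 < e / 2 by rewrite divr_gt0.
have [N NP] := unif _ e20; exists N => k Nk.
apply: (@le_lt_trans _ _ (e / 2)); last by rewrite ltr_pdivrMr// ltr_pMr// ltr1n.
by rewrite rE; apply/linf_rnorm_le => n; exact: NP.
Qed.

HB.instance Definition _ := Uniform_isComplete.Build linf linf_complete.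

Lemma linf_delta_bounded (j : nat) : linf_pred (fun n => (n == j)%:R).
Proof.
apply/asboolP; exists 1 => n; case: eqP => _; rewrite /rnorm.
  by rewrite normr1 rp1.
by rewrite normr0 rp0.
Qed.

Lemma linf_infinite_dimensional : infinite_dimensional (linf : lmodType K).
Proof.
move=> [n [e he]].
have [c cP] := choice (fun j : 'I_n.+1 => he (Linf (linf_delta_bounded j))).
(* The n + 1 unit sequences in the span of n vectors would factor an identity matrix of size n + 1
   through dimension n. *)
have : (\matrix_(j < n.+1, i < n) c j i) *m
    (\matrix_(i < n, k < n.+1) ((e i : nat -> K^o) k : K)) = 1%:M :> 'M[K]_n.+1.
  apply/matrixP => j k; rewrite !mxE.
  have /(congr1 (fun u : linf => (u : nat -> K^o) k)) := cP j.
  have -> : (\sum_(i < n) c j i *: e i : linf) k = \sum_(i < n) c j i * e i k.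
    by elim/big_ind2 : _ => // x1 x2 y1 y2 <- <-.
  rewrite /= => kj; rewrite eq_sym -val_eqE kj.
  by apply: eq_bigr => i _; rewrite !mxE.
by move=> /mulmx1_min; rewrite ltnn.
Qed.

End linf.

Theorem theorem5p1 (R : realType) (K : numFieldType)
    (K_RC : real_or_complex R K)
    (F : set_system nat) (F_filter : ProperFilter F) (F_free : free_filter F) :
  [<-> exists2 X : completeNormedModType K, infinite_dimensional X &
         uniform_boundedness_principle F X;
       forall X : tvsType K, frechet R X -> uniform_boundedness_principle F X;
       rapid_plus_filter F /\ P_plus_filter F].
Proof.
have [D] := real_or_complex_form K_RC.
have fr_ubp : rapid_plus_filter F /\ P_plus_filter F ->
    forall X : tvsType K, frechet R X -> uniform_boundedness_principle F X.
  by move=> [Fr FP] X frX; exact: (ubp_frechet D F_filter F_free frX Fr FP).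
have nec (X : normedModType K) : infinite_dimensional X ->
    uniform_boundedness_principle F X -> rapid_plus_filter F /\ P_plus_filter F.
  move=> infX ubpX; split; first exact: (ubp_rapid_plus D F_filter F_free infX ubpX).
  exact: (ubp_P_plus D F_filter infX ubpX).
tfae.
- by move=> [X infX ubpX] X' frX'; apply: fr_ubp frX'; exact: nec infX ubpX.
- move=> frU; apply: (nec (linf D)); first exact: linf_infinite_dimensional.
  exact/frU/banach_frechet.
- move=> FrP; exists (linf D : completeNormedModType K); first exact: linf_infinite_dimensional.
  by apply: fr_ubp => //; exact: (banach_frechet D (linf D : completeNormedModType K)).
Qed.
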